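(* For $k\in\mathbb N$ and $g\in C^2((\mathbb R^d)^k)$ with bounded second derivatives, let $\tilde\Phi_g:\mathbb H\to\mathbb R$ be $$\tilde\Phi_g(x)=\int_{\Omega^k}g\big(x(\omega_1),\dots,x(\omega_k)\big)\,d\omega_1\cdots d\omega_k .$$ Then for any $\alpha\in(0,1]$ and $k\in\mathbb N$, $$\dim\Big(C^{2,\alpha}_{\rm loc}(\mathbb H)\cap\big\{\tilde\Phi_g\;:\;g\in C^{2,\alpha}_{\rm loc}((\mathbb R^d)^k),\ \|D^2g\|_{L^\infty}<\infty\big\}\Big)<\infty.$$
   Context: $\Omega=(0,1)^d$ with Lebesgue measure, $\mathbb H=L^2(\Omega;\mathbb R^d)$. $C^{2,\alpha}_{\rm loc}(\mathbb H)$ is the set of twice continuously Fréchet differentiable functions $\tilde\Phi:\mathbb H\to\mathbb R$ whose Hessian $\nabla^2\tilde\Phi$ (a bounded bilinear form valued map) is $\alpha$-Hölder continuous on every ball of $\mathbb H$. $C^{2,\alpha}_{\rm loc}((\mathbb R^d)^k)$ is the usual space of $C^2$ functions with locally $\alpha$-Hölder second derivatives. $\dim$ is the dimension as a real vector space. *)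

(* Defs.v *)
From HB Require Import structures.
From mathcomp Require Import all_boot all_order all_algebra.
From mathcomp Require Import generic_quotient ring_quotient.
From mathcomp Require Import all_classical all_reals all_analysis.
From mathcomp Require Import measurable_realfun.
From mathcomp Require Import ring lra.

Set Implicit Arguments.
Unset Strict Implicit.
Unset Printing Implicit Defensive.

Import Order.TTheory GRing.Theory Num.Theory.
Import numFieldNormedType.Exports.

Local Open Scope classical_set_scope.
Local Open Scope ring_scope.

Section product_power.
Context {dT : measure_display} {T : measurableType dT} {R : realType}.
Variable mu : {sigma_finite_measure set T -> \bar R}.

Definition tcons n (p : T * n.-tuple T) : n.+1.-tuple T := [tuple of p.1 :: p.2].

Lemma measurable_tcons n : measurable_fun [set: T * n.-tuple T] (@tcons n).
Proof.
by apply: (@measurable_cons _ _ (T * n.-tuple T)%type T fst n snd).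
Qed.

Section step.
Variables (n : nat) (nu : {sigma_finite_measure set (n.-tuple T) -> \bar R}).

(* The product measure [mu \x nu], transported along [T * T^n ~ T^(n+1)]. *)
Definition mcons : set (n.+1.-tuple T) -> \bar R :=
  pushforward (mu \x nu)%E (@tcons n).

Let mt := @measurable_tcons n.

Let mcons0 : mcons set0 = 0%E. Proof. exact: measure0. Qed.

Let mcons_ge0 A : (0 <= mcons A)%E. Proof. exact: measure_ge0. Qed.

Let mcons_sigma_additive : semi_sigma_additive mcons.
Proof. exact: measure_semi_sigma_additive. Qed.

HB.instance Definition _ := isMeasure.Build _ _ _ mcons
  mcons0 mcons_ge0 mcons_sigma_additive.

Let mcons_sigma_finite : sigma_finite setT mcons.
Proof.
have /sigma_finiteP[F [TF ndF Foo]] := sigma_finiteT mu.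
have /sigma_finiteP[G [TG ndG Goo]] := sigma_finiteT nu.
pose u (t : n.+1.-tuple T) := (thead t, [tuple of behead t] : n.-tuple T).
have mu_ : measurable_fun setT u.
  apply: measurable_fun_pair; last exact: measurable_behead.
  exact: measurable_tnth.
exists (fun i => u @^-1` (F i `*` G i)).
  apply/seteqP; split => // t _.
  have : setT (thead t) by []. rewrite TF => -[i _ Fi].
  have : setT ([tuple of behead t] : n.-tuple T) by []. rewrite TG => -[j _ Gj].
  exists (maxn i j) => //; split => /=.
    by move: Fi; exact/subsetPset/ndF/leq_maxl.
  by move: Gj; exact/subsetPset/ndG/leq_maxr.
move=> i; have [mF Fy] := Foo i; have [mG Gy] := Goo i.
have mFG : measurable (F i `*` G i) by exact: measurableX.
split.
  by rewrite -[X in measurable X]setTI; exact: mu_.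
rewrite /mcons /pushforward -comp_preimage.
have -> : u \o @tcons n = id.
  by apply/funext => -[x t]; congr pair; apply: val_inj.
by rewrite preimage_id product_measure1E// lte_mul_pinfty// ge0_fin_numE.
Qed.

HB.instance Definition _ := Measure_isSigmaFinite.Build _ _ _ mcons
  mcons_sigma_finite.

End step.

(* The [n]-fold product measure of [mu], on [T^n]; for [n = 0] this is the unit
   mass on the one-point space. *)
Fixpoint mpower n : {sigma_finite_measure set (n.-tuple T) -> \bar R} :=
  match n with
  | 0%N => \d_([tuple] : 0.-tuple T)
  | m.+1 => mcons (mpower m)
  end.

End product_power.

Section cube.
Context (R : realType) (d : nat).

Definition lebesgueRn : {sigma_finite_measure set (d.-tuple (measurableTypeR R)) -> \bar R} :=
  mpower (@lebesgue_measure R) d.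

Definition Omega : set (d.-tuple (measurableTypeR R)) :=
  [set w | forall i, 0 < tnth w i < 1].

Lemma measurable_Omega : measurable Omega.
Proof.
rewrite (_ : Omega = \bigcap_(i in [set: 'I_d]) ((@tnth _ _ ^~ i) @^-1` `]0 : R, 1[%classic)).
  apply: fin_bigcap_measurable => // i _.
  rewrite -[X in measurable X]setTI.
  exact: measurable_tnth.
apply/seteqP; split => [w Ow i _|w Ow i] /=.
  by rewrite in_itv/=; exact: Ow.
by have := Ow i Logic.I; rewrite /= in_itv.
Qed.

(* Lebesgue measure of the open unit cube, as a measure on the whole of [R^d]
   carried by [Omega]. *)
Definition muOmega : set (d.-tuple (measurableTypeR R)) -> \bar R :=
  mrestr lebesgueRn measurable_Omega.

HB.instance Definition _ := Measure.on muOmega.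

Let muOmega_sigma_finite : sigma_finite setT muOmega.
Proof.
have [F TF Foo] := sigma_finiteT lebesgueRn; exists F => // i.
have [mF Fy] := Foo i; split=> //; apply: le_lt_trans Fy.
have mO := measurable_Omega.
by rewrite /muOmega /mrestr le_measure ?inE//; exact: measurableI.
Qed.

HB.instance Definition _ := Measure_isSigmaFinite.Build _ _ _ muOmega
  muOmega_sigma_finite.

End cube.

Section euclidean_norm.
Context {R : rcfType} {n : nat}.
Implicit Types u v : 'rV[R]_n.

(* The library norm of ['rV[R]_n] is the maximum norm. *)
Definition enorm v : R := Num.sqrt (\sum_(i < n) v 0 i ^+ 2).

Lemma enorm_ge0 v : 0 <= enorm v.
Proof. exact: sqrtr_ge0. Qed.

Lemma enorm_sqr v : enorm v ^+ 2 = \sum_(i < n) v 0 i ^+ 2.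
Proof. by rewrite sqr_sqrtr// sumr_ge0// => i _; rewrite sqr_ge0. Qed.

Lemma enormZ a v : enorm (a *: v) = `|a| * enorm v.
Proof.
rewrite /enorm; under eq_bigr do rewrite mxE exprMn.
by rewrite -mulr_sumr sqrtrM ?sqr_ge0// sqrtr_sqr.
Qed.

Lemma enorm_eq0 v : enorm v = 0 -> v = 0.
Proof.
move=> v0; have := enorm_sqr v; rewrite v0 expr0n/= => /esym/eqP.
rewrite psumr_eq0 => [/allP v0'|i _]; last by rewrite sqr_ge0.
apply/rowP => i; rewrite mxE; apply/eqP; rewrite -sqrf_eq0.
by apply: v0'; rewrite mem_index_enum.
Qed.

Lemma enorm0 : enorm 0 = 0.
Proof. by rewrite -(scale0r 0) enormZ normr0 mul0r. Qed.

Lemma enormD u v : enorm (u + v) <= enorm u + enorm v.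
Proof.
have [/enorm_eq0 ->|u0] := eqVneq (enorm u) 0; first by rewrite add0r enorm0 add0r.
have [/enorm_eq0 ->|v0] := eqVneq (enorm v) 0; first by rewrite addr0 enorm0 addr0.
rewrite -(@ler_pXn2r _ 2)// ?nnegrE ?addr_ge0 ?enorm_ge0//.
set a := enorm u; set b := enorm v; set s := \sum_(i < n) u 0 i * v 0 i.
have ab0 : 0 < a * b by rewrite mulr_gt0// lt0r ?u0 ?v0 enorm_ge0.
have sab : s <= a * b.
  have : 0 <= \sum_(i < n) (b * u 0 i - a * v 0 i) ^+ 2.
    by rewrite sumr_ge0// => i _; rewrite sqr_ge0.
  rewrite (eq_bigr (fun i => b ^+ 2 * u 0 i ^+ 2 + a ^+ 2 * v 0 i ^+ 2
      - (2 * a * b) * (u 0 i * v 0 i))); last by move=> i _; ring.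
  rewrite sumrB big_split/= -!mulr_sumr -!enorm_sqr -/a -/b -/s.
  have -> : b ^+ 2 * a ^+ 2 + a ^+ 2 * b ^+ 2 - 2 * a * b * s
    = 2 * ((a * b) * (a * b - s)) by ring.
  by rewrite pmulr_rge0// pmulr_rge0// subr_ge0.
rewrite enorm_sqr (eq_bigr (fun i => u 0 i ^+ 2 + v 0 i ^+ 2
    + 2 * (u 0 i * v 0 i))); last by move=> i _; rewrite mxE; ring.
rewrite !big_split/= -mulr_sumr -!enorm_sqr -/a -/b -/s.
by rewrite sqrrD -mulr_natl; lra.
Qed.

End euclidean_norm.

Section L2.
Context {dT : measure_display} {T : measurableType dT} {R : realType}.
Variables (mu : {measure set T -> \bar R}) (n : nat).
Implicit Types f g : T -> 'rV[R]_n.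

Definition norm2 f : \bar R := 'N[mu]_2%:E [EFin \o (enorm \o f)].

Definition measurable_coord f :=
  forall i, measurable_fun [set: T] (fun t => f t 0 i).

Definition square_integrable : {pred T -> 'rV[R]_n} :=
  fun f => `[< measurable_coord f /\ (norm2 f < +oo)%E >].

Lemma measurable_enorm f :
  measurable_coord f -> measurable_fun [set: T] (enorm \o f).
Proof.
move=> mf; apply: (@measurableT_comp _ _ _ _ _ _ (@Num.Def.sqrtr R)).
  exact: continuous_measurable_fun (@sqrt_continuous R).
by apply: measurable_sum => i; exact: measurable_funX.
Qed.

Lemma measurable_abse_sqr (h : T -> R) : measurable_fun [set: T] h ->
  measurable_fun [set: T] (fun t => `|(EFin \o h) t| `^ 2)%E.
Proof.
move=> mh; apply/measurable_EFinP.
apply: (@measurableT_comp _ _ _ _ _ _ (@powR R ^~ 2)) => //.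
exact: measurableT_comp.
Qed.

Lemma norm2D f g : measurable_coord f -> measurable_coord g ->
  (norm2 (f + g)%R <= norm2 f + norm2 g)%E.
Proof.
move=> mf mg.
have mef := measurable_enorm mf; have meg := measurable_enorm mg.
have mfg : measurable_fun [set: T] (enorm \o (f + g)).
  apply: measurable_enorm => i.
  rewrite (_ : (fun t => _) = (fun t => f t 0 i) \+ (fun t => g t 0 i)).
    exact: measurable_funD.
  by apply/funext => t; rewrite /= mxE.
apply: (le_trans _ (@eminkowski _ _ _ mu _ _ 2%:E mef meg _)); last first.
  by rewrite lee_fin ler1n.
rewrite /norm2 unlock; apply: gt0_ler_poweR; rewrite ?invr_ge0//.
- by rewrite in_itv/= leey andbT integral_ge0// => t _; exact: poweR_ge0.
- by rewrite in_itv/= leey andbT integral_ge0// => t _; exact: poweR_ge0.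
apply: ge0_le_integral => //.
- by move=> t _; exact: poweR_ge0.
- exact: measurable_abse_sqr.
- by apply: measurable_abse_sqr; exact: measurable_funD.
move=> t _; rewrite /= lee_fin ge0_ler_powR ?nnegrE//.
by rewrite ger0_norm ?enorm_ge0// ger0_norm ?addr_ge0 ?enorm_ge0// enormD.
Qed.

Lemma norm2Z a f : f \in square_integrable -> norm2 (a *: f) = (`|a|%:E * norm2 f)%E.
Proof.
move=> /asboolP[mf ff].
have p1 : (1 <= 2%:E :> \bar R)%E by rewrite lee_fin ler1n.
have Lf : enorm \o f \in Lfun mu 2%:E.
  by rewrite inE; apply/andP; rewrite !inE; split => //; exact: measurable_enorm.
have := LnormZ (Lfun_Sub p1 Lf) `|a|.
rewrite Lfun_valP normr_id /norm2 => <-.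
by apply: eq_Lnorm => t /=; rewrite enormZ.
Qed.

Lemma square_integrable_submod : submod_closed square_integrable.
Proof.
have sZ a f : f \in square_integrable -> a *: f \in square_integrable.
  move=> sf; have /asboolP[mf ff] := sf; apply/asboolP; split => [i|].
    rewrite (_ : (fun t => _) = (fun t => a * f t 0 i)).
      exact: measurable_funM.
    by apply/funext => t; rewrite mxE.
  by rewrite norm2Z// lte_mul_pinfty ?lee_fin.
split.
  apply/asboolP; split => [i|].
    rewrite (_ : (fun t => _) = cst 0) //.
    by apply/funext => t; rewrite mxE.
  rewrite /norm2 (_ : _ \o _ = cst 0%E) ?Lnorm0 ?eqe//.
  by apply/funext => t /=; rewrite enorm0.
move=> a f g /(sZ a)/asboolP[mf ff] /asboolP[mg fg].
apply/asboolP; split => [i|].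
  rewrite (_ : (fun t => _) = (fun t => (a *: f) t 0 i) \+ (fun t => g t 0 i)).
    exact: measurable_funD.
  by apply/funext => t; rewrite /= mxE.
by apply: (le_lt_trans (norm2D mf mg)); rewrite lte_add_pinfty.
Qed.

HB.instance Definition _ := GRing.isSubmodClosed.Build R _ square_integrable
  square_integrable_submod.

Record L2fun := MkL2fun {
  L2val :> T -> 'rV[R]_n ;
  L2valP : L2val \in square_integrable }.
HB.instance Definition _ := [isSub for L2val].
HB.instance Definition _ := [Choice of L2fun by <:].
HB.instance Definition _ := [SubChoice_isSubLmodule of L2fun by <:].

Lemma L2valB (f g : L2fun) t : (f - g) t = f t - g t.
Proof.
by have -> : L2val (f - g) = L2val f - L2val g by exact: (raddfB (val : L2fun -> _)).
Qed.

Lemma L2valZ a (f : L2fun) t : (a *: f) t = a *: f t.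
Proof.
by have -> : L2val (a *: f) = a *: L2val f by exact: (linearZZ (val : L2fun -> _)).
Qed.

Definition ae_zero : {pred L2fun} :=
  fun f : L2fun => `[< {ae mu, forall t, f t = 0} >].

Lemma ae_zero_zmod : zmod_closed ae_zero.
Proof.
split; first by apply/asboolP; exact: nearW.
move=> f g /asboolP f0 /asboolP g0; apply/asboolP.
by apply: filterS2 f0 g0 => t; rewrite L2valB => -> ->; rewrite subr0.
Qed.

HB.instance Definition _ := GRing.isZmodClosed.Build _ ae_zero ae_zero_zmod.

(* [L^2(mu; R^n)]: square-integrable functions modulo equality almost
   everywhere, normed by [(\int |x|^2 d mu)^(1/2)]. *)
Definition L2 : Type := {ideal_quot ae_zero}.
HB.instance Definition _ := GRing.Zmodule.on L2.
HB.instance Definition _ := EqQuotient.on L2.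

Definition L2_class (f : L2fun) : L2 := \pi_({ideal_quot ae_zero})%qT f.

(* A representative of the class [x]. *)
Definition L2_fun (x : L2) : T -> 'rV[R]_n := L2val (repr x).

Definition L2_scale (a : R) (x : L2) : L2 := L2_class (a *: repr x).

Definition L2_norm (x : L2) : R := fine (norm2 (L2_fun x)).

Lemma L2_classP (f g : L2fun) :
  L2_class f = L2_class g <-> {ae mu, forall t, f t = g t}.
Proof.
have E : (L2_class f == L2_class g) = (f - g \in ae_zero).
  by rewrite Quotient.idealrBE.
split=> [/eqP|fg]; last apply/eqP; rewrite E.
  by move/asboolP; apply: filterS => t; rewrite L2valB => /eqP; rewrite subr_eq0 => /eqP.
by apply/asboolP; apply: filterS fg => t; rewrite L2valB => ->; rewrite subrr.
Qed.

Lemma L2_classK (x : L2) : L2_class (repr x) = x.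
Proof. exact: (@reprK _ {ideal_quot ae_zero} x). Qed.

Lemma repr_L2_class (f : L2fun) :
  {ae mu, forall t, (repr (L2_class f) : L2fun) t = f t}.
Proof. by apply/L2_classP; exact: L2_classK. Qed.

Lemma L2_classD (f g : L2fun) : L2_class (f + g) = L2_class f + L2_class g.
Proof. exact: Quotient.pi_add. Qed.

Lemma L2_classZ a (f : L2fun) : L2_scale a (L2_class f) = L2_class (a *: f).
Proof.
apply/L2_classP; have := repr_L2_class f.
by apply: filterS => t; rewrite !L2valZ => ->.
Qed.

Let scaleA a b (x : L2) : L2_scale a (L2_scale b x) = L2_scale (a * b) x.
Proof. by rewrite -[x]L2_classK !L2_classZ scalerA. Qed.

Let scale1 : left_id 1 L2_scale.
Proof. by move=> x; rewrite -[x]L2_classK !L2_classZ scale1r. Qed.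

Let scaleDr : right_distributive L2_scale +%R.
Proof.
move=> a x y; rewrite -[x]L2_classK -[y]L2_classK -L2_classD !L2_classZ.
by rewrite scalerDr L2_classD.
Qed.

Let scaleDl (x : L2) : {morph L2_scale^~ x : a b / a + b}.
Proof.
move=> a b /=; rewrite -[x]L2_classK !L2_classZ.
by rewrite scalerDl L2_classD.
Qed.

HB.instance Definition _ := GRing.Zmodule_isLmodule.Build R L2
  scaleA scale1 scaleDr scaleDl.

Lemma norm2_ae f g : measurable_coord f -> measurable_coord g ->
  {ae mu, forall t, f t = g t} -> norm2 f = norm2 g.
Proof.
move=> mf mg fg; rewrite /norm2 unlock; apply: (congr1 (fun I => poweR I 2^-1)).
apply: ge0_ae_eq_integral.
- exact: measurableT.
- by apply: measurable_abse_sqr; exact: measurable_enorm.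
- by apply: measurable_abse_sqr; exact: measurable_enorm.
- by move=> t _; exact: poweR_ge0.
- by move=> t _; exact: poweR_ge0.
by apply: filterS fg => t fgt _; rewrite /= fgt.
Qed.

Lemma L2_norm_class (f : L2fun) : (L2_norm (L2_class f))%:E = norm2 f.
Proof.
have /asboolP[mf ff] := L2valP f.
have /asboolP[mf' _] := L2valP (repr (L2_class f)).
rewrite /L2_norm /L2_fun (norm2_ae mf' mf (repr_L2_class f)) fineK//.
by rewrite fin_numElt ff andbT (lt_le_trans _ (Lnorm_ge0 _ _ _)).
Qed.

Let L2_normD (x y : L2) : L2_norm (x + y) <= L2_norm x + L2_norm y.
Proof.
rewrite -[x]L2_classK -[y]L2_classK -L2_classD -lee_fin EFinD !L2_norm_class.
have /asboolP[mx _] := L2valP (repr x).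
have /asboolP[my _] := L2valP (repr y).
exact: norm2D.
Qed.

Let L2_normZ a (x : L2) : L2_norm (a *: x) = `|a| * L2_norm x.
Proof.
rewrite -[x]L2_classK; rewrite [_ *: _]L2_classZ.
by apply: EFin_inj; rewrite EFinM !L2_norm_class norm2Z// L2valP.
Qed.

Let L2_norm0_eq0 (x : L2) : L2_norm x = 0 -> x = 0.
Proof.
move=> x0; have -> : 0 = L2_class 0.
  rewrite -[in RHS](scale0r 0) -L2_classZ; exact/esym/(@scale0r _ L2).
have := L2_norm_class (repr x); rewrite L2_classK x0 /norm2 => /esym xn0.
have /asboolP[mx _] := L2valP (repr x).
have xm : measurable_fun setT (EFin \o (enorm \o L2val (repr x))).
  by apply/measurable_EFinP; exact: measurable_enorm.
have p0 : (0 < 2%:E :> \bar R)%E by rewrite lte_fin.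
rewrite -[LHS]L2_classK; apply/L2_classP.
apply: filterS (Lnorm_eq0_eq0 xm p0 xn0) => t /(_ Logic.I)[].
exact: enorm_eq0.
Qed.

HB.instance Definition _ := Lmodule_isNormed.Build R L2
  L2_normD L2_normZ L2_norm0_eq0.

Lemma L2_normE (x : L2) : `|x| = L2_norm x.
Proof. by []. Qed.

End L2.

Section frechet.
Context {R : realType} {V : normedModType R}.
Implicit Types (f : V -> R) (B : V -> V -> R).

(* The operator norm of the bilinear form [B] is at most [M]. *)
Definition bilin_le B (M : R) : Prop :=
  forall u v, `|B u v| <= M * (`|u| * `|v|).

(* The second derivative [D(Df)(x)[u][v]]; meaningful when
   [twice_differentiable f x] holds. *)
Definition hessian f (x : V) : V -> V -> R :=
  fun u v => 'd (fun y => 'd f y v) x u.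

(* [Df], with values in the dual of [V] under the operator norm, is Fréchet
   differentiable at [x], with derivative the bounded bilinear form
   [hessian f x]. *)
Definition twice_differentiable f (x : V) : Prop :=
  (exists M, bilin_le (hessian f x) M) /\
  forall e, 0 < e -> \forall h \near (0 : V), forall v,
    `|'d f (x + h) v - 'd f x v - hessian f x h v| <= e * (`|h| * `|v|).

Definition C2 f : Prop :=
  [/\ forall x, differentiable f x,
      forall x, twice_differentiable f x
    & forall x e, 0 < e -> \forall y \near x,
        bilin_le (fun u v => hessian f y u v - hessian f x u v) e].

(* In finite dimension, Hölder continuity on every ball is the same as local
   Hölder continuity. *)
Definition C2alpha_loc (alpha : R) f : Prop :=
  C2 f /\ forall (x0 : V) (r : R), exists M : R,
    forall x y, ball x0 r x -> ball x0 r y ->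
      bilin_le (fun u v => hessian f x u v - hessian f y u v)
               (M * `|x - y| `^ alpha).

Definition bounded_hessian f : Prop :=
  exists M : R, forall x, bilin_le (hessian f x) M.

End frechet.

(* [S] is a linear subspace of [V] of finite dimension, i.e. the span of a
   finite family. *)
Definition finite_dimensional {R : realType} {V : lmodType R} (S : set V) :
    Prop :=
  exists (n : nat) (b : 'I_n -> V),
    S = [set \sum_(i < n) c i *: b i | c in [set: 'I_n -> R]].

(* [L^2(Omega; R^d)] *)
Definition HH (R : realType) (d : nat) : normedModType R := L2 (@muOmega R d) d.

(* Elements of [(R^d)^k] are the [k x d] matrices, the [i]-th row being the
   [i]-th vector. The integral is over [Omega^k], which carries the product
   measure [mpower muOmega k]. *)
Definition tildePhi (R : realType) (d k : nat) (g : 'M[R]_(k, d) -> R)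
    (x : HH R d) : R :=
  \int[mpower (@muOmega R d) k]_w
    g (\matrix_(i < k, j < d) L2_fun x (tnth w i) 0 j).

(* Main.v *)
From HB Require Import structures.
Require Import Defs.
From mathcomp Require Import all_boot all_order all_algebra.
From mathcomp Require Import fingroup perm.
From mathcomp Require Import all_classical all_reals all_analysis.
From mathcomp Require Import measurable_realfun.
From mathcomp Require Import ring lra.

Set Implicit Arguments.
Unset Strict Implicit.
Unset Printing Implicit Defensive.

Import Order.TTheory GRing.Theory Num.Theory.
Import numFieldNormedType.Exports.

Local Open Scope classical_set_scope.
Local Open Scope ring_scope.

(* Let [h] be a vector times the indicator of a set of measure [e]. If [tildePhi g]
   is twice differentiable at [x], its third difference at [x] along [h] is
   [o(|h|^2) = o(e)]. On step functions [tildePhi g] is a finite sum in which the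
   measures of the level sets enter polynomially, so the coefficient of [e] in that
   third difference must vanish. Polarizing in the remaining measures, one finds that
   the symmetrization of [g] over the permutations of its [k] arguments has zero third
   differences in each of its [k d] real variables. Being continuous, it is a
   polynomial of degree at most 2 in each variable, hence determined by its values at
   the points with coordinates in {0, 1, 2}. Since [tildePhi g] depends only on the
   symmetrization of [g], these finitely many values determine [tildePhi g]. *)

(** * Linear algebra and third differences on the line *)

(** Among the finite families in [A], take one whose images under [c] span a space of largest
    dimension. Then [c g] lies in that span for every [g] in [A], so [g] minus a combination of the
    family lies in [A] and in the kernel of [c], hence is killed by [Phi]. [Phi] is assumed linear
    on [A] only, as integration is linear only on integrable functions. *)
Lemma finite_dimensional_image (R : realType) (E V : lmodType R) (A : set E)
    (n : nat) (c : {linear E -> 'rV[R]_n}) (Phi : E -> V) :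
  A 0 ->
  (forall a f g, A f -> A g -> A (a *: f + g)) ->
  (forall a f g, A f -> A g -> Phi (a *: f + g) = a *: Phi f + Phi g) ->
  (forall f, A f -> c f = 0 -> Phi f = 0) ->
  finite_dimensional (Phi @` A).
Proof.
move=> A0 AD PhiD Phi0.
have Phi_0 : Phi 0 = 0 by apply: Phi0; rewrite ?linear0.
have AS (r : nat) (a : 'I_r -> R) (f : 'I_r -> E) : (forall i, A (f i)) ->
    A (\sum_(i < r) a i *: f i) /\
    Phi (\sum_(i < r) a i *: f i) = \sum_(i < r) a i *: Phi (f i).
  elim: r a f => [|r IHr] a f Af; first by rewrite !big_ord0.
  rewrite !big_ord_recl /=; have [] := IHr (a \o lift ord0) (f \o lift ord0).
    by move=> i; exact: Af.
  by move=> As Ps; split; [exact: AD|rewrite PhiD// Ps].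
pose P m := `[< exists s : seq E, {in s, forall f, A f} /\
  \dim <<[seq c f | f <- s]>> = m >].
have exP : exists m, P m.
  by exists (\dim <<[seq c f | f <- [::]]>>); apply/asboolP; exists [::].
have leP m : P m -> (m <= \dim {:'rV[R]_n})%N.
  by move=> /asboolP[s [_ <-]]; exact/dimvS/subvf.
case: (ex_maxnP exP leP) => m /asboolP[s [sA sm]] mmax.
have sAi (i : 'I_(size s)) : A s`_i by apply: sA; rewrite mem_nth.
exists (size s), (fun i => Phi s`_i); apply/seteqP; split; last first.
  move=> _ [a _ <-]; have [As Ps] := AS _ a _ sAi.
  by exists (\sum_(i < size s) a i *: s`_i).
move=> _ [g Ag <-].
have cg : c g \in <<[seq c f | f <- s]>>%VS.
  have /eqP -> : <<[seq c f | f <- s]>>%VS == <<[seq c f | f <- g :: s]>>%VS.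
    rewrite eqEdim /= span_cons addvSr -span_cons sm; apply: mmax.
    apply/asboolP; exists (g :: s); split=> // f; rewrite inE => /predU1P[->//|].
    exact: sA.
  by rewrite memv_span//= mem_head.
pose X : (size s).-tuple 'rV[R]_n := map_tuple c (in_tuple s).
have /(coord_span (X := X)) cgE := cg.
exists (fun i => coord X i (c g)) => //.
have [As <-] := AS _ (fun i => coord X i (c g)) _ sAi.
set h := \sum_(i < _) _ in As *.
have : Phi ((- 1) *: h + g) = 0.
  apply: Phi0; first exact: AD.
  rewrite linearD linearZZ scaleN1r linear_sum; apply/eqP.
  rewrite addrC subr_eq0; apply/eqP; rewrite {1}cgE; apply: eq_bigr => i _.
  by rewrite linearZ/= (nth_map 0).
by rewrite PhiD// scaleN1r addrC => /eqP; rewrite subr_eq0 => /eqP ->.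
Qed.

Lemma floor_grid_cvg (R : realType) (t : R) :
  (fun n => (Num.floor (t * n.+1%:R))%:~R / n.+1%:R) @ \oo --> t.
Proof.
apply/cvgrPdist_le => e e0; near=> n.
have n0 : 0 < n.+1%:R :> R by [].
have /andP[h1 h2] := floor_itv (t * n.+1%:R).
set q : R := (Num.floor _)%:~R in h1 *.
have {}h2 : t * n.+1%:R < q + 1 by move: h2; rewrite intrD1.
have -> : t - q / n.+1%:R = (t * n.+1%:R - q) / n.+1%:R.
  by rewrite mulrBl mulfK// gt_eqF.
rewrite ger0_norm; last by rewrite divr_ge0// subr_ge0.
rewrite ler_pdivrMr//.
have : 1 / n.+1%:R < e by rewrite div1r; near: n; exact: (near_infty_natSinv_lt (PosNum e0)).
rewrite ltr_pdivrMr// => ne.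
by rewrite (le_trans _ (ltW ne))// lerBlDr addrC ltW.
Unshelve. all: by end_near. Qed.

Definition third_difference_free (R : realType) (f : R -> R) :=
  forall t s, f (t + 3 * s) - 3 * f (t + 2 * s) + 3 * f (t + s) - f t = 0.

(* On each grid [(1/n) Z], [n > 0], the three-term recursion makes [f] a
   quadratic polynomial, with the three zeros [0], [1] and [2]. *)
Lemma third_difference_free_eq0 (R : realType) (f : R -> R) :
  continuous f -> third_difference_free f ->
  f 0 = 0 -> f 1 = 0 -> f 2 = 0 -> f = cst 0.
Proof.
move=> cf f3 f0 f1 f2.
have fnat (n : nat) (m : nat) : (0 < n)%N -> f (m%:R / n%:R) = 0.
  move=> n0; set u := fun m : nat => f (m%:R / n%:R).
  have n0R : n%:R != 0 :> R by rewrite pnatr_eq0 -lt0n.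
  have rec i : u i.+3 = 3 * u i.+2 - 3 * u i.+1 + u i.
    have := f3 (i%:R / n%:R) n%:R^-1; rewrite /u.
    rewrite -(addn3 i) -(addn2 i) -(addn1 i) !natrD !mulrDl div1r.
    by move=> /eqP; lra.
  (* [a] and [b] are the coefficients of the quadratic polynomial that interpolates [u] at the
     indices 0, 1 and 2; the recursion carries the identity to every index. *)
  pose b := (4 * u 1%N - u 2%N - 3 * u 0%N) / 2.
  pose a := (u 2%N - 2 * u 1%N + u 0%N) / 2.
  have quad i : u i = a * i%:R ^+ 2 + b * i%:R + u 0%N.
    have : [/\ u i = a * i%:R ^+ 2 + b * i%:R + u 0%N,
       u i.+1 = a * i.+1%:R ^+ 2 + b * i.+1%:R + u 0%N &
       u i.+2 = a * i.+2%:R ^+ 2 + b * i.+2%:R + u 0%N].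
      elim: i => [|i [h0 h1 h2]]; first by rewrite /a /b; split; lra.
      split=> //; rewrite rec h0 h1 h2 -(addn3 i) -(addn2 i) -(addn1 i) !natrD.
      ring.
    by case.
  (* The indices 0, [n] and [2 * n] are the points 0, 1 and 2, so the quadratic has three zeros. *)
  have u0 : u 0%N = 0 by rewrite /u mul0r.
  have un : u n = 0 by rewrite /u divff.
  have u2n : u (2 * n)%N = 0 by rewrite /u natrM mulfK.
  have := quad n; have := quad (2 * n)%N; rewrite u0 un u2n natrM => h2 h1.
  have an : a * n%:R ^+ 2 = 0 by lra.
  have bn : b * n%:R = 0 by lra.
  have /eqP := an; rewrite mulf_eq0 expf_eq0 (negPf n0R) andbF orbF => /eqP a0.
  have /eqP := bn; rewrite mulf_eq0 (negPf n0R) orbF => /eqP b0.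
  by have := quad m; rewrite a0 b0 u0 /u => ->; ring.
have fge0 t : 0 <= t -> f t = 0.
  move=> t0.
  have : f ((Num.floor (t * n.+1%:R))%:~R / n.+1%:R) @[n --> \oo] --> f t.
    by apply: continuous_cvg; [exact: cf|exact: floor_grid_cvg].
  rewrite (_ : (fun n => _) = cst 0); last first.
    apply/funext => n /=; have : 0 <= Num.floor (t * n.+1%:R).
      by rewrite floor_ge0 mulr_ge0.
    by case: (Num.floor _) => // m _; exact: fnat.
  by move=> /cvg_lim <- //; rewrite lim_cst.
apply/funext => t; have [t0|t0] := leP 0 t; first exact: fge0.
(* For negative [t], the third difference from [t] with step [- t] involves, besides [t], only the
   nonnegative points 0, [- t] and [- 2 t]. *)
have t0' := fge0 _ (lexx 0).
have t1 : f (t + 2 * - t) = 0 by apply: fge0; lra.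
have t2 : f (t + 3 * - t) = 0 by apply: fge0; lra.
by have := f3 t (- t); rewrite subrr t0' t1 t2 /=; lra.
Qed.

(** * Twice differentiable functions *)

Section second_order_differentiability.
Context {R : realType} {V : normedModType R}.
Implicit Types (f g : V -> R) (x y h u v : V).

(** ['d] is a linear map by its type, so it remains to see its continuity, from the bound [M], and
    the remainder estimate. The denominator [|v| + 1] absorbs the factor [|v|] and stays positive
    for [v = 0]. *)
Lemma twice_differentiable_diff f x v : twice_differentiable f x ->
  differentiable (fun y => 'd f y v) x.
Proof.
move=> [[M fM] fx]; apply/diff_locallyP; split.
  apply/linear_bounded_continuous/linear_boundedP.
  exists (M * `|v|); split; first exact: num_real.
  move=> r Mr u; apply: (le_trans (fM u v)).
  by rewrite mulrCA mulrC ler_wpM2r// ltW.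
apply/eqaddoP => e e0.
have v1 : 0 < `|v| + 1 by rewrite ltr_wpDl.
have e1 : 0 < e / (`|v| + 1) by rewrite divr_gt0.
have := fx _ e1; apply: filterS => h hP.
rewrite [X in `|X|](_ : _ = 'd f (x + h) v - 'd f x v - hessian f x h v); last first.
  by rewrite !fctE /= [h + x]addrC opprD addrA.
apply: (le_trans (hP v)); rewrite mulrCA mulrC ler_wpM2r//.
by rewrite mulrAC ler_pdivrMr// ler_wpM2l ?(ltW e0)// lerDl.
Qed.

Lemma is_derive_line f x h (t : R) : differentiable f (x + t *: h) ->
  is_derive t (1 : R) (fun s : R => f (x + s *: h)) ('d f (x + t *: h) h).
Proof.
move=> df.
have dl : is_diff t (fun s : R => x + s *: h) (fun s => s *: h).
  by apply: is_diff_eq; rewrite add0r.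
have dc : differentiable (f \o (fun s : R => x + s *: h)) t.
  by apply: differentiable_comp => //; exact: ex_diff.
apply: DeriveDef; first exact: diff_derivable.
rewrite deriveE// diff_comp//=.
by rewrite diff_val scale1r.
Qed.

(** Third differences annihilate quadratic polynomials, so [f] may be replaced along the line by its
    second-order Taylor remainder [p]. The derivative of [p] is the remainder in the
    differentiability of ['d f] at [x], and the mean value theorem does the rest. *)
Lemma third_difference_small f x :
  (forall y, differentiable f y) -> twice_differentiable f x ->
  forall e, 0 < e -> \forall h \near (0 : V),
    `|f (x + 3 *: h) - 3 * f (x + 2 *: h) + 3 * f (x + h) - f x| <= e * `|h| ^+ 2.
Proof.
move=> df [_ fx] e e0.
(* 36 is 3 times 12: [t <= 3] in the bound on [dp t], and the increments of [p] over the lengths 3,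
   2 and 1 enter with coefficients 1, 3 and 3, in total 3 + 6 + 3 = 12. *)
have e1 : 0 < e / 36 by rewrite divr_gt0.
have /nbhs_norm0P[r /= r0 fr] := fx _ e1.
apply/nbhs_norm0P; exists (r / 3) => /=; first by rewrite divr_gt0.
move=> h /= hr.
pose p t := f (x + t *: h) - t * 'd f x h - t ^+ 2 * (hessian f x h h / 2).
pose dp t := 'd f (x + t *: h) h - 'd f x h - t * hessian f x h h.
have pD (t : R) : is_derive t (1 : R) p (dp t).
  have := is_derive_line (df (x + t *: h)) => ?.
  apply: is_derive_eq; rewrite /dp !scaler0 /GRing.scale /= !mulr1 !add0r.
  move: (hessian f x h h : R) ('d f x h : R) ('d f (x + t *: h) h : R) => c b a.
  by field.
have dpE : forall t : R, 0 <= t <= 3 -> `|dp t| <= e / 36 * (3 * `|h| ^+ 2).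
  move=> t /andP[s0 s3]; have := fr (t *: h) => /=.
  rewrite normrZ (ger0_norm s0) => /(_ _ h).
  rewrite /hessian linearZ/= -/(hessian f x h h) -/(dp t) => P.
  have {P}/le_trans : `|dp t| <= e / 36 * (t * `|h| * `|h|).
    apply: P; apply: (@le_lt_trans _ _ (3 * `|h|)); first exact: ler_wpM2r.
    by rewrite mulrC -ltr_pdivlMr.
  apply; rewrite ler_wpM2l ?(ltW e1)// expr2 mulrA ler_wpM2r// ler_wpM2r//.
have pE (a : R) : 0 <= a <= 3 -> `|p a - p 0| <= a * (e / 36 * (3 * `|h| ^+ 2)).
  move=> /andP[a0 a3].
  have [|c] := @MVT_segment _ p dp 0 a a0 (fun t _ => pD t).
    apply: continuous_subspaceT => t.
    by apply/differentiable_continuous/derivable1_diffP; have := pD t => ?; exact: ex_derive.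
  rewrite in_itv/= => /andP[c0 ca] ->; rewrite subr0 normrM (ger0_norm a0) mulrC.
  by rewrite ler_wpM2l// dpE// c0/= (le_trans ca).
have := pE 1; have := pE 2; have := pE 3.
set K := `|h| ^+ 2.
have -> : f (x + 3 *: h) - 3 * f (x + 2 *: h) + 3 * f (x + h) - f x =
    (p 3 - p 0) - 3 * (p 2 - p 0) + 3 * (p 1 - p 0).
  rewrite /p scale1r scale0r addr0.
  move: (hessian f x h h : R) ('d f x h : R) (f (x + 3 *: h)) (f (x + 2 *: h)).
  by move: (f (x + h)) (f x) => c4 c3 c2 c1 b a; field.
have i1 : 0 <= (1 : R) <= 3 by apply/andP; split; lra.
have i2 : 0 <= (2 : R) <= 3 by apply/andP; split; lra.
have i3 : 0 <= (3 : R) <= 3 by apply/andP; split; lra.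
move=> /(_ i3) h3 /(_ i2) h2 /(_ i1) h1.
apply: (le_trans (ler_normD _ _)); rewrite normrM.
apply: (le_trans (lerD (ler_normB _ _) (lexx _))); rewrite normrM.
rewrite !(ger0_norm (ler0n _ _)).
have eK : e / 36 * (3 * K) = e * K / 12 by field.
by rewrite eK in h1 h2 h3; lra.
Qed.

Lemma ler_norm_lincomb (a p q M M' N : R) :
  `|p| <= M * N -> `|q| <= M' * N -> `|a * p + q| <= (`|a| * M + M') * N.
Proof.
move=> pM qM'; apply: (le_trans (ler_normD _ _)).
by rewrite normrM mulrDl -mulrA lerD// ler_wpM2l.
Qed.

Lemma bilin_leD (B B' : V -> V -> R) (a M M' : R) : bilin_le B M -> bilin_le B' M' ->
  bilin_le (fun u v => a * B u v + B' u v) (`|a| * M + M').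
Proof. by move=> BM BM' u v; exact: ler_norm_lincomb. Qed.

Lemma diff_lincomb f g (a : R) x v : differentiable f x -> differentiable g x ->
  'd (a *: f + g) x v = a * 'd f x v + 'd g x v.
Proof.
move=> df dg; have daf : differentiable (a *: f) x by exact: differentiableZ.
apply: (etrans (congr1 (fun F => F v) (diffD daf dg))).
exact: (congr1 (fun F : V -> R => F v + 'd g x v) (diffZ a df)).
Qed.

Lemma lincombB2 (a p q p' q' : R) :
  a * p + p' - (a * q + q') = a * (p - q) + (p' - q').
Proof. by ring. Qed.

Lemma lincombB3 (a p q r p' q' r' : R) :
  a * p + p' - (a * q + q') - (a * r + r') = a * (p - q - r) + (p' - q' - r').
Proof. by ring. Qed.

Lemma hessian_lincomb f g (a : R) x :
  (forall y, differentiable f y) -> (forall y, differentiable g y) ->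
  twice_differentiable f x -> twice_differentiable g x ->
  hessian (a *: f + g) x = fun u v => a * hessian f x u v + hessian g x u v.
Proof.
move=> df dg fx gx; have E v : (fun y => 'd (a *: f + g) y v) =
    a *: (fun y => 'd f y v) + (fun y => 'd g y v).
  by apply/funext => y; rewrite diff_lincomb.
apply/funext => u; apply/funext => v; rewrite /hessian E.
by apply: diff_lincomb; exact: twice_differentiable_diff.
Qed.

Lemma C2_lincomb f g (a : R) : C2 f -> C2 g -> C2 (a *: f + g).
Proof.
move=> [df tf cf] [dg tg cg].
have small e : 0 < e -> 0 < e / (`|a| + 1) /\ `|a| * (e / (`|a| + 1)) + e / (`|a| + 1) = e.
  move=> e0; have a1 : 0 < `|a| + 1 by rewrite ltr_wpDl.
  split; first by rewrite divr_gt0.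
  by rewrite -[X in _ + X]mul1r -mulrDl mulrC divfK// gt_eqF.
split => x.
- by apply: differentiableD => //; exact: differentiableZ.
- rewrite /twice_differentiable hessian_lincomb//.
  have [[Mf fM] fx] := tf x; have [[Mg gM] gx] := tg x; split.
    by exists (`|a| * Mf + Mg); exact: bilin_leD.
  move=> e /small[e1 eE].
  have := gx _ e1; have := fx _ e1; apply: filterS2 => h hf hg v.
  rewrite !diff_lincomb//.
  by rewrite lincombB3 -eE; apply: ler_norm_lincomb; [exact: hf|exact: hg].
- move=> e /small[e1 eE].
  have := cg x _ e1; have := cf x _ e1; apply: filterS2 => y hf hg.
  rewrite !hessian_lincomb// -eE => u v.
  rewrite lincombB2.
  by apply: ler_norm_lincomb; [exact: hf|exact: hg].
Qed.

Lemma C2alpha_loc_lincomb (alpha : R) f g (a : R) :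
  C2alpha_loc alpha f -> C2alpha_loc alpha g -> C2alpha_loc alpha (a *: f + g).
Proof.
move=> [cf hf] [cg hg]; split; first exact: C2_lincomb.
have [df tf _] := cf; have [dg tg _] := cg.
move=> x0 r; have [Mf fM] := hf x0 r; have [Mg gM] := hg x0 r.
exists (`|a| * Mf + Mg) => x y xr yr; rewrite !hessian_lincomb// => u v.
rewrite lincombB2 -mulrA.
by apply: ler_norm_lincomb; rewrite mulrA; [exact: fM|exact: gM].
Qed.

Lemma bounded_hessian_lincomb f g (a : R) : C2 f -> C2 g ->
  bounded_hessian f -> bounded_hessian g -> bounded_hessian (a *: f + g).
Proof.
move=> [df tf _] [dg tg _] [Mf fM] [Mg gM]; exists (`|a| * Mf + Mg) => x.
rewrite hessian_lincomb//; exact: bilin_leD.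
Qed.

Lemma hessian0 x : hessian (0 : V -> R) x = fun _ _ => 0.
Proof.
have d0 y v : 'd (0 : V -> R) y v = 0 by rewrite (diff_cst (0 : R) y).
apply/funext => u; apply/funext => v; rewrite /hessian.
by rewrite (_ : (fun y => _) = 0) ?d0//; apply/funext => y; rewrite d0.
Qed.

Lemma bilin_le0 : bilin_le (fun _ _ : V => 0 : R) 0.
Proof. by move=> u v; rewrite normr0 mul0r. Qed.

Lemma C2alpha_loc0 (alpha : R) : C2alpha_loc alpha (0 : V -> R).
Proof.
have d0 y v : 'd (0 : V -> R) y v = 0 by rewrite (diff_cst (0 : R) y).
split; [split => x|].
- exact: differentiable_cst.
- rewrite /twice_differentiable hessian0; split; first by exists 0; exact: bilin_le0.
  move=> e e0; apply: nearW => h v.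
  by rewrite !d0 !subr0 normr0 !mulr_ge0// ltW.
- move=> e e0; apply: nearW => y; rewrite !hessian0 => u v.
  by rewrite subr0 normr0 !mulr_ge0// ltW.
- move=> x0 r; exists 0 => x y _ _; rewrite !hessian0 mul0r => u v.
  by rewrite subr0 normr0 mul0r.
Qed.

Lemma bounded_hessian0 : bounded_hessian (0 : V -> R).
Proof. by exists 0 => x; rewrite hessian0; exact: bilin_le0. Qed.

(** The mean value theorem is applied twice along the segment from 0 to [x], first to the derivative
    and then to [f]. Quadratic growth is what makes [g] integrable along square-integrable
    functions. *)
Lemma bounded_hessian_growth f : C2 f -> bounded_hessian f ->
  exists C : R, 0 <= C /\ forall x, `|f x| <= C * (1 + `|x| ^+ 2).
Proof.
move=> [df tf _] [M fM].
have /linear_bounded_continuous/linear_boundedP dfb := diff_continuous (df 0).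
have [K [K0 dfK]] : exists K, 0 <= K /\ forall x, `|'d f 0 x| <= K * `|x|.
  by have [K [K0 Kp]] := pinfty_ex_gt0 dfb; exists K; split => //; exact: ltW.
exists (`|f 0| + K + `|M|); split; first by rewrite !addr_ge0.
move=> x.
have p1 (t : R) : is_derive t (1 : R) (fun s : R => f (0 + s *: x)) ('d f (t *: x) x).
  by have := is_derive_line (df (0 + t *: x)); rewrite add0r.
have p2 (t : R) : is_derive t (1 : R) (fun s : R => 'd f (0 + s *: x) x)
    (hessian f (t *: x) x x).
  have := is_derive_line (twice_differentiable_diff x (tf (0 + t *: x))).
  by rewrite add0r.
have cont (q dq : R -> R) : (forall t : R, is_derive t (1 : R) q (dq t)) ->
    forall a b : R, {within `[a, b], continuous q}.
  move=> qD a b; apply: continuous_subspaceT => t.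
  by apply/differentiable_continuous/derivable1_diffP; have := qD t => ?; exact: ex_derive.
have d1 (t : R) : 0 <= t <= 1 -> `|'d f (t *: x) x - 'd f 0 x| <= `|M| * `|x| ^+ 2.
  move=> /andP[t0 t1].
  have [|c] := @MVT_segment _ _ _ 0 t t0 (fun s _ => p2 s); first exact: (cont _ _ p2).
  rewrite in_itv/= scale0r !add0r subr0 => /andP[c0 ct] ->.
  rewrite normrM (ger0_norm t0); apply: (@le_trans _ _ (`|M| * `|x| ^+ 2 * 1)); last first.
    by rewrite mulr1.
  apply: ler_pM => //; apply: (le_trans (fM _ _ _)).
  by rewrite -expr2 ler_wpM2r// ?sqr_ge0// ler_norm.
have [|c] := @MVT_segment _ _ _ 0 1 ler01 (fun s _ => p1 s); first exact: (cont _ _ p1).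
rewrite in_itv/= scale1r scale0r !add0r subr0 mulr1 => c01 fx.
have := d1 c c01; have := dfK x; rewrite -fx => hK hM.
have x2 : `|x| <= 1 + `|x| ^+ 2.
  by have := sqr_ge0 (`|x| - 1); have := sqr_ge0 `|x|; rewrite sqrrB1 -mulr_natl; lra.
rewrite -[f x](subrK (f 0)) -[f x - f 0](subrK ('d f 0 x)).
apply: (le_trans (ler_normD _ _)); apply: (le_trans (lerD (ler_normD _ _) (lexx _))).
have x0 := normr_ge0 x; have xx := sqr_ge0 `|x|.
have := normr_ge0 (f 0); have := normr_ge0 M.
have := ler_wpM2l K0 x2; have := mulr_ge0 (normr_ge0 (f 0)) xx.
rewrite !mulrDl !mulrDr; lra.
Qed.

End second_order_differentiability.

(** * Finite product measures *)

Section product_power_theory.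
Context {dT : measure_display} {T : measurableType dT} {R : realType}.
Variable mu : {sigma_finite_measure set T -> \bar R}.

Definition box n (A : 'I_n -> set T) : set (n.-tuple T) :=
  [set t | forall i, A i (tnth t i)].

Lemma measurable_box n (A : 'I_n -> set T) : (forall i, measurable (A i)) ->
  measurable (box A).
Proof.
move=> mA; rewrite (_ : box A = \bigcap_(i in [set: 'I_n]) ((@tnth _ _ ^~ i) @^-1` A i)).
  apply: fin_bigcap_measurable => // i _.
  by rewrite -[X in measurable X]setTI; exact: measurable_tnth.
by apply/seteqP; split => [t At i _|t At i] /=; [exact: At|exact: (At i Logic.I)].
Qed.

Lemma mpower_box n (A : 'I_n -> set T) (m : 'I_n -> R) :
  (forall i, measurable (A i)) -> (forall i, mu (A i) = (m i)%:E) ->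
  mpower mu n (box A) = (\prod_(i < n) m i)%:E.
Proof.
elim: n A m => [|n IHn] A m mA Am.
  rewrite big_ord0 /= diracE mem_set//= => -[]//.
rewrite /= /mcons /pushforward.
rewrite (_ : _ @^-1` _ = A ord0 `*` box (A \o lift ord0)); last first.
  apply/seteqP; split=> [[x t] /= At|[x t] /= [Ax At] i].
    split; first by have := At ord0; rewrite (tnth_nth x).
    by move=> i; have := At (lift ord0 i); rewrite !(tnth_nth x).
  case: (unliftP ord0 i) => [j ->|->]; last by rewrite (tnth_nth x).
  by have := At j; rewrite !(tnth_nth x).
rewrite product_measure1E//; last by apply: measurable_box => i; exact: mA.
by rewrite big_ord_recl (IHn _ (m \o lift ord0))//= Am.
Qed.

Lemma preimage_tnth_box n (i : 'I_n) (C : set T) :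
  (@tnth n T ^~ i) @^-1` C = box (fun j => if j == i then C else setT).
Proof.
apply/seteqP; split => [t Ct j|t /(_ i)] /=; last by rewrite eqxx.
by case: eqP => [->|].
Qed.

(** Boxes are stable under intersection, unlike the coordinate preimages by which the sigma-algebra
    is generated; uniqueness of measures needs such a generating family. *)
Lemma measurable_tuple_boxes n :
  @measurable _ (n.-tuple T) = <<s [set B | exists2 A : 'I_n -> set T,
    forall i, measurable (A i) & B = box A] >>.
Proof.
apply/seteqP; split; last first.
  apply: smallest_sub; first exact: sigma_algebra_measurable.
  by move=> _ [A mA ->]; exact: measurable_box.
apply: smallest_sub; first exact: smallest_sigma_algebra.
case: n => [|n] B; first by rewrite big_ord0.
rewrite -bigcup_mkord_ord => -[i Ii [C mC <-]].
apply: sub_sigma_algebra; rewrite setTI preimage_tnth_box.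
exists (fun j => if j == inord i then C else setT) => // j.
by case: eqP.
Qed.

Hypothesis mu1 : mu setT = 1%E.

Lemma fin_num_probability A : measurable A -> mu A \is a fin_num.
Proof.
move=> mA; rewrite ge0_fin_numE//; apply: le_lt_trans (ltry 1).
by rewrite -[1%:E]mu1 le_measure ?inE.
Qed.

Lemma mpower_box_fine n (A : 'I_n -> set T) : (forall i, measurable (A i)) ->
  mpower mu n (box A) = (\prod_(i < n) fine (mu (A i)))%:E.
Proof.
by move=> mA; apply: mpower_box => // i; rewrite fineK// fin_num_probability.
Qed.

Lemma mpower_unique n (nu : {measure set (n.-tuple T) -> \bar R}) :
  (forall A : 'I_n -> set T, (forall i, measurable (A i)) ->
    nu (box A) = (\prod_(i < n) fine (mu (A i)))%:E) ->
  forall B, measurable B -> nu B = mpower mu n B.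
Proof.
move=> nuE; have setTbox : [set: n.-tuple T] = box (fun=> setT) by apply/seteqP; split.
move=> B mB.
apply: (@measure_unique _ _ _ _ (fun=> setT) (measurable_tuple_boxes n) _ _ _
  nu (mpower mu n)) => // {B mB}.
- move=> _ _ [A mA ->] [B mB ->]; exists (fun i => A i `&` B i) => [i|].
    exact: measurableI.
  by apply/seteqP; split => [t [At Bt] i|t ABt]; split => // i; have [] := ABt i.
- by move=> _; exists (fun=> setT).
- by apply/seteqP; split => // t _; exists 0%N.
- by move=> _ [A mA ->]; rewrite nuE//; exact/esym/mpower_box_fine.
- by move=> _; rewrite setTbox nuE// ltry.
Qed.

Definition tuple_perm n (s : 'S_n) (t : n.-tuple T) : n.-tuple T :=
  [tuple tnth t (s i) | i < n].

Lemma measurable_tuple_perm n (s : 'S_n) : measurable_fun setT (@tuple_perm n s).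
Proof.
apply/measurable_fun_tnthP => i.
rewrite (_ : _ \o _ = @tnth _ _ ^~ (s i)); first exact: measurable_tnth.
by apply/funext => t /=; rewrite tnth_mktuple.
Qed.

(** A permutation of the coordinates maps boxes to boxes and only reorders the product of the
    masses. This invariance is why [tildePhi g] sees no more of [g] than its symmetrization. *)
Lemma mpower_perm n (s : 'S_n) B : measurable B ->
  pushforward (mpower mu n) (tuple_perm s) B = mpower mu n B.
Proof.
move=> mB; pose mp := measurable_tuple_perm s.
apply: (mpower_unique (nu := pushforward (mpower mu n) (tuple_perm s))) => // A mA.
transitivity (mpower mu n (box (A \o (s^-1)%g))).
  congr (mpower mu n _); apply/seteqP; split => t At i /=.
    by have := At (s^-1 i)%g; rewrite tnth_mktuple permKV.
  by rewrite tnth_mktuple; have := At (s i); rewrite /= permK.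
rewrite mpower_box_fine => [|i]; last exact: mA.
congr EFin; rewrite (reindex_inj (@perm_inj _ s)) /=.
by apply: eq_bigr => i _; rewrite permK.
Qed.

Lemma mpower_tnth n (i : 'I_n) C : measurable C ->
  pushforward (mpower mu n) (@tnth n T ^~ i) C = mu C.
Proof.
move=> mC; rewrite /pushforward preimage_tnth_box.
rewrite mpower_box_fine => [|j]; last by case: eqP.
rewrite (bigD1 i)//= eqxx big1 ?mulr1 => [|j /negPf ->]; last by rewrite mu1.
by rewrite fineK// fin_num_probability.
Qed.

Lemma mpowerT n : mpower mu n setT = 1%E.
Proof.
rewrite (_ : setT = box (fun=> setT)); last by apply/seteqP; split.
by rewrite mpower_box_fine// big1// => i _; rewrite mu1.
Qed.

End product_power_theory.

(** * Integrals over the product space *)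

Section matrix_valued.
Context {dU : measure_display} {U : measurableType dU} {R : realType} {k d : nat}.

Lemma measurable_floor_eq (f : U -> R) (z : int) : measurable_fun setT f ->
  measurable [set w | Num.floor (f w) = z].
Proof.
move=> mf; rewrite (_ : [set w | _] = f @^-1` `[z%:~R, (z + 1)%:~R[%classic).
  by rewrite -[X in measurable X]setTI; exact: mf.
apply/seteqP; split => w /=; rewrite in_itv/=; first by move=> <-; exact: floor_itv.
by move=> /floor_def.
Qed.

(** Integer matrices are countable, so the preimage of any set is a countable union of fibres of
    [Z], each a finite intersection of measurable sets. Hence [q] can be arbitrary. *)
Lemma measurable_mx_int (Z : U -> 'M[int]_(k, d)) (q : 'M[int]_(k, d) -> R) :
  (forall i j z, measurable [set w | Z w i j = z]) ->
  measurable_fun setT (q \o Z).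
Proof.
move=> mZ _ B mB; rewrite setTI.
rewrite (_ : _ @^-1` B = \bigcup_A (if `[< B (q A) >] then
    \bigcap_(p in [set: 'I_k * 'I_d]) [set w | Z w p.1 p.2 = A p.1 p.2] else set0)).
  apply: countable_bigcupT_measurable => [|A]; first exact: countableP.
  by case: ifP => // _; apply: fin_bigcap_measurable => // p _; exact: mZ.
apply/seteqP; split => [w /= Bw|w [A _]].
  by exists (Z w) => //; rewrite asboolT//.
case: asboolP => // BA ZA /=; rewrite (_ : Z w = A)//.
by apply/matrixP => i j; exact: (ZA (i, j) Logic.I).
Qed.

(* Rounding the entries down to [(1/n) Z] presents [g \o M] as a pointwise limit
   of functions that factor through the countable type of integer matrices. *)
Lemma measurable_continuous_mx (M : U -> 'M[R]_(k, d)) (g : 'M[R]_(k, d) -> R) :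
  (forall i j, measurable_fun setT (fun w => M w i j)) -> continuous g ->
  measurable_fun setT (g \o M).
Proof.
move=> mM cg.
pose Z n w : 'M[int]_(k, d) := \matrix_(i, j) Num.floor (M w i j * n.+1%:R).
pose q n (A : 'M[int]_(k, d)) : 'M[R]_(k, d) := \matrix_(i, j) ((A i j)%:~R / n.+1%:R).
apply: (@measurable_fun_cvg _ _ _ _ (fun n w => g (q n (Z n w)))) => [n|w _].
  apply: (measurable_mx_int (g \o q n)) => i j z.
  rewrite (_ : [set w | _] = [set w | Num.floor (M w i j * n.+1%:R) = z]); last first.
    by apply/funext => w /=; rewrite mxE.
  by apply: measurable_floor_eq; exact: measurable_funM.
apply: continuous_cvg; first exact: cg.
apply/cvg_ballP => e e0.
have : \forall n \near \oo, forall i j,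
    ball (M w i j) e ((Num.floor (M w i j * n.+1%:R))%:~R / n.+1%:R).
  apply: filter_forall => i; apply: filter_forall => j.
  by have /cvg_ballP/(_ e e0) := @floor_grid_cvg _ (M w i j).
by apply: filterS => n nP; split => // i j; rewrite !mxE; exact: nP.
Qed.

Lemma mx_norm_sqr_le (A : 'M[R]_(k, d)) : `|A| ^+ 2 <= \sum_i \sum_j A i j ^+ 2.
Proof.
have s0 i : 0 <= \sum_j A i j ^+ 2 by apply: sumr_ge0 => j _; exact: sqr_ge0.
have [->|/mx_norm_neq0[[i j] /= E]] := eqVneq `|A| 0.
  by rewrite expr0n /= sumr_ge0.
rewrite [`|A|]E real_normK ?num_real//.
rewrite (bigD1 i)//= (bigD1 j)//= -addrA lerDl addr_ge0 ?sumr_ge0// => *.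
exact: sqr_ge0.
Qed.

End matrix_valued.

Section lifted_integral.
Context {dT : measure_display} {T : measurableType dT} {R : realType} {k d : nat}.
Variable mu : {sigma_finite_measure set T -> \bar R}.
Hypothesis mu1 : mu setT = 1%E.
Implicit Types (z : T -> 'rV[R]_d) (g : 'M[R]_(k, d) -> R).

Definition lift_mx z (w : k.-tuple T) : 'M[R]_(k, d) :=
  \matrix_(i < k, j < d) z (tnth w i) 0 j.

Lemma measurable_lift_mx z g : measurable_coord z -> continuous g ->
  measurable_fun setT (g \o lift_mx z).
Proof.
move=> mz cg; apply: measurable_continuous_mx => // i j.
rewrite (_ : (fun w => _) = (fun t => z t 0 j) \o (@tnth _ _ ^~ i)); last first.
  by apply/funext => w; rewrite /lift_mx mxE.
by apply: measurableT_comp; [exact: mz|exact: measurable_tnth].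
Qed.

Lemma square_integrable_coord z (j : 'I_d) : z \in square_integrable mu (n := d) ->
  (\int[mu]_t ((z t 0 j) ^+ 2)%:E < +oo)%E.
Proof.
move=> /asboolP[mz]; rewrite /norm2 unlock => /lty_poweRy.
rewrite invr_eq0 pnatr_eq0 => /(_ isT); apply: le_lt_trans.
apply: ge0_le_integral => //.
- by move=> t _; rewrite lee_fin sqr_ge0.
- by apply/measurable_EFinP; apply: measurable_funX; exact: mz.
- by apply: measurable_abse_sqr; exact: measurable_enorm.
move=> t _ /=; rewrite lee_fin powR_mulrn// real_normK ?num_real//.
rewrite enorm_sqr (bigD1 j)//= lerDl sumr_ge0// => i _; exact: sqr_ge0.
Qed.

Lemma ge0_integral_tnth (i : 'I_k) (f : T -> R) : measurable_fun setT f ->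
  (forall t, 0 <= f t) ->
  (\int[mpower mu k]_w (f (tnth w i))%:E = \int[mu]_t (f t)%:E)%E.
Proof.
move=> mf f0.
have mt : measurable_fun setT (@tnth k T ^~ i) by exact: measurable_tnth.
rewrite -(@ge0_integral_pushforward _ _ _ _ _ _ mt (mpower mu k) setT (EFin \o f))//.
- by apply: eq_measure_integral => A mA _; exact: mpower_tnth.
- exact/measurable_EFinP.
- by move=> t _; rewrite lee_fin.
Qed.

(** The growth bound dominates the integrand by a constant plus squares that depend on one
    coordinate of [w] each. Every marginal of the product measure is [mu], so these squares
    integrate to finite values. *)
Lemma integrable_lift_mx z g (C : R) : z \in square_integrable mu (n := d) ->
  continuous g -> (forall A, `|g A| <= C * (1 + `|A| ^+ 2)) ->
  (mpower mu k).-integrable setT (EFin \o (g \o lift_mx z)).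
Proof.
move=> sz cg gC; have /asboolP[mz _] := sz.
have C0 : 0 <= C.
  by have := le_trans (normr_ge0 _) (gC 0); rewrite normr0 expr0n/= addr0 mulr1.
have mzX (i : 'I_k) (j : 'I_d) :
    measurable_fun setT (fun w : k.-tuple T => (z (tnth w i) 0 j) ^+ 2).
  apply: measurable_funX.
  exact: (measurableT_comp (mz j) (measurable_tnth i)).
pose D (w : k.-tuple T) : \bar R :=
  (C%:E * (1%:E + \sum_(i < k) \sum_(j < d) ((z (tnth w i) 0 j) ^+ 2)%R%:E))%E.
apply: (@le_integrable _ _ _ _ _ measurableT _ D).
- by apply/measurable_EFinP; exact: measurable_lift_mx.
- move=> w _; rewrite /D /=.
  under eq_bigr do rewrite sumEFin.
  rewrite sumEFin -EFinD -EFinM /= lee_fin; apply: (le_trans (gC _)).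
  apply: le_trans (ler_norm _); rewrite ler_wpM2l// lerD2l.
  apply: (le_trans (mx_norm_sqr_le _)); rewrite le_eqVlt; apply/orP; left.
  by apply/eqP/eq_bigr => i _; apply: eq_bigr => j _; rewrite mxE.
apply: integrableZl => //; apply: integrableD => //.
  apply/integrableP; split; first exact: measurable_cst.
  under eq_integral do rewrite /= normr1.
  rewrite integral_cst// mul1e; apply: (@le_lt_trans _ _ 1%E); last exact: ltry.
  by rewrite le_eqVlt; apply/orP; left; apply/eqP; exact: mpowerT.
apply: integrable_sum => // i _; apply: integrable_sum => // j _.
apply/integrableP; split; first exact/measurable_EFinP.
under eq_integral => w _ do rewrite /= ger0_norm ?sqr_ge0//.
rewrite (ge0_integral_tnth i (f := fun t => (z t 0 j) ^+ 2)).
- exact: square_integrable_coord.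
- by apply: measurable_funX; exact: mz.
- by move=> t; exact: sqr_ge0.
Qed.

Lemma lift_mx_tuple_perm z (s : 'S_k) w :
  lift_mx z (tuple_perm s w) = row_perm s (lift_mx z w).
Proof. by apply/matrixP => i j; rewrite !mxE tnth_mktuple. Qed.

Lemma integrable_tuple_perm (f : k.-tuple T -> R) (s : 'S_k) :
  (mpower mu k).-integrable setT (EFin \o f) ->
  (mpower mu k).-integrable setT (EFin \o (f \o tuple_perm s)).
Proof.
move=> /integrableP[mf fy]; have mp := measurable_tuple_perm (T := T) s.
apply/integrableP; split; first by apply: (measurableT_comp mf mp).
rewrite -(@ge0_integral_pushforward _ _ _ _ _ _ mp (mpower mu k) setT
  (fun w => `|(EFin \o f) w|%E))//; last exact: measurableT_comp.
by rewrite (eq_measure_integral (mpower mu k))// => A mA _; exact: mpower_perm.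
Qed.

Lemma Rintegral_tuple_perm (f : k.-tuple T -> R) (s : 'S_k) :
  (mpower mu k).-integrable setT (EFin \o f) ->
  \int[mpower mu k]_w f (tuple_perm s w) = \int[mpower mu k]_w f w.
Proof.
move=> fi; have mp := measurable_tuple_perm (T := T) s.
rewrite /Rintegral; congr fine.
transitivity (\int[pushforward (mpower mu k) (tuple_perm s)]_w (f w)%:E)%E.
  rewrite (integral_pushforward mp (f := EFin \o f)) ?preimage_setT//.
    by have /integrableP[] := fi.
  exact: integrable_tuple_perm.
by apply: eq_measure_integral => A mA _; exact: mpower_perm.
Qed.

End lifted_integral.

(** * Step functions *)

Section finite_valued.
Context {dU : measure_display} {U : measurableType dU} {R : realType}.
Variable mu : {measure set U -> \bar R}.

Lemma Rintegral_sum (I : Type) (r : seq I) (f : I -> U -> R) :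
  (forall i, mu.-integrable setT (EFin \o f i)) ->
  \int[mu]_u (\sum_(i <- r) f i u) = \sum_(i <- r) \int[mu]_u f i u.
Proof.
move=> fi; elim: r => [|i r IHr].
  rewrite big_nil; under eq_Rintegral do rewrite big_nil.
  by rewrite /Rintegral integral0_eq.
rewrite big_cons; under eq_Rintegral do rewrite big_cons.
rewrite RintegralD ?IHr//.
rewrite (_ : EFin \o _ = (fun u => \sum_(j <- r) (f j u)%:E)%E).
  by apply: integrable_sum => // j _; exact: fi.
by apply/funext => u /=; rewrite sumEFin.
Qed.

Hypothesis mu1 : mu setT = 1%E.

Lemma integrable_cst_prob (a : R) : mu.-integrable setT (EFin \o cst a).
Proof.
apply/integrableP; split; first exact/measurable_EFinP/measurable_cst.
by under eq_integral do rewrite /=; rewrite integral_cst// mu1 mule1 ltry.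
Qed.

Variables (I : finType) (c : U -> I).
Hypothesis mc : forall r, measurable (c @^-1` [set r]).

Lemma measurable_finite_valued (phi : I -> R) : measurable_fun setT (phi \o c).
Proof.
move=> _ B mB; rewrite setTI.
rewrite (_ : _ @^-1` B = \bigcup_(r in [set r | B (phi r)]) c @^-1` [set r]).
  by apply: fin_bigcup_measurable => //; exact: finite_finset.
by apply/seteqP; split => [u /= Bu|u [r /= Br ->]] //; exists (c u).
Qed.

Lemma integrable_finite_valued (phi : I -> R) :
  mu.-integrable setT (EFin \o (phi \o c)).
Proof.
apply: (le_integrable measurableT _ _ (integrable_cst_prob (\sum_r `|phi r|))).
  exact/measurable_EFinP/measurable_finite_valued.
move=> u _ /=; rewrite lee_fin [leRHS]ger0_norm ?sumr_ge0//.
by rewrite (bigD1 (c u))//= lerDl sumr_ge0.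
Qed.

Lemma Rintegral_finite_valued (phi : I -> R) :
  \int[mu]_u phi (c u) = \sum_r fine (mu (c @^-1` [set r])) * phi r.
Proof.
have E u : phi (c u) = \sum_r phi r * (c u == r)%:R.
  rewrite (bigD1 (c u))//= eqxx mulr1 big1 ?addr0// => r.
  by rewrite eq_sym => /negPf ->; rewrite mulr0.
under eq_Rintegral do rewrite E.
rewrite (Rintegral_sum _ (f := fun r u => phi r * (c u == r)%:R)) => [|r]; last first.
  exact: (integrable_finite_valued (fun s => phi r * (s == r)%:R)).
apply: eq_bigr => r _.
rewrite RintegralZl//; last exact: (integrable_finite_valued (fun s => (s == r)%:R)).
rewrite mulrC; congr (_ * _); rewrite /Rintegral; congr fine.
rewrite -[c @^-1` [set r]]setIT -integral_indic//; apply: eq_integral => u _.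
rewrite indicE; congr (_%:R%:E); case: eqP => [<-|cr]; first by rewrite mem_set.
by rewrite memNset.
Qed.

End finite_valued.

Section step_functions.
Context {dT : measure_display} {T : measurableType dT} {R : realType} {d : nat}.
Variable mu : {sigma_finite_measure set T -> \bar R}.
Hypothesis mu1 : mu setT = 1%E.
Variables (I : finType) (c : T -> I).
Hypothesis mc : forall r, measurable (c @^-1` [set r]).

Lemma step_square_integrable (y : I -> 'rV[R]_d) :
  (y \o c) \in square_integrable mu (n := d).
Proof.
have my : measurable_coord (y \o c).
  by move=> j; exact: (measurable_finite_valued mc (fun r => y r 0 j)).
apply/asboolP; split => //; rewrite /norm2 unlock; apply: poweR_lty.
have /integrableP[_] := integrable_finite_valued mu1 mc (fun r => enorm (y r) ^+ 2).
apply: le_lt_trans; rewrite le_eqVlt; apply/orP; left; apply/eqP.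
apply: eq_integral => t _ /=; congr EFin.
by rewrite powR_mulrn// real_normK ?num_real// ger0_norm// sqr_ge0.
Qed.

Definition step (y : I -> 'rV[R]_d) : L2 mu d := L2_class (MkL2fun (step_square_integrable y)).

Lemma step_lincomb (a : R) (y y' : I -> 'rV[R]_d) :
  step y + a *: step y' = step (fun r => y r + a *: y' r).
Proof.
rewrite [a *: _]L2_classZ -[LHS]L2_classD; apply/L2_classP.
apply: nearW => t /=; congr (_ + _); exact: L2valZ.
Qed.

Lemma step_norm_sqr (y : I -> 'rV[R]_d) :
  `|step y| ^+ 2 = \sum_r fine (mu (c @^-1` [set r])) * enorm (y r) ^+ 2.
Proof.
rewrite -(Rintegral_finite_valued mu1 mc (fun r => enorm (y r) ^+ 2)).
have := L2_norm_class (MkL2fun (step_square_integrable y)).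
rewrite L2_normE /step => /(congr1 fine) /= ->; rewrite /norm2 unlock /Rintegral.
rewrite [X in poweR X _](_ : _ = (\int[mu]_u (enorm (y (c u)) ^+ 2)%:E)%E); last first.
  apply: eq_integral => t _ /=; congr EFin.
  by rewrite powR_mulrn// real_normK ?num_real.
have I0 : (0 <= \int[mu]_u (enorm (y (c u)) ^+ 2)%:E)%E.
  by apply: integral_ge0 => u _; rewrite lee_fin sqr_ge0.
have Iy : (\int[mu]_u (enorm (y (c u)) ^+ 2)%:E < +oo)%E.
  have /integrableP[_] := integrable_finite_valued mu1 mc (fun r => enorm (y r) ^+ 2).
  apply: le_lt_trans; rewrite le_eqVlt; apply/orP; left; apply/eqP.
  by apply: eq_integral => u _ /=; rewrite ger0_norm ?sqr_ge0.
case: (integral _ _ _) I0 Iy => [r| |]//=; rewrite lee_fin => r0 _.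
by rewrite powR12_sqrt// sqr_sqrtr.
Qed.

Lemma ae_mpower_tnth (k : nat) (z z' : T -> 'rV[R]_d) :
  {ae mu, forall t, z t = z' t} ->
  {ae mpower mu k, forall w, forall q, z (tnth w q) = z' (tnth w q)}.
Proof.
move=> zz'; apply: filter_forall => q.
have [N [mN N0 zN]] := zz'; exists (@tnth k T ^~ q @^-1` N); split.
- by rewrite -[X in measurable X]setTI; exact: measurable_tnth.
- by rewrite -N0; exact: mpower_tnth.
- by move=> w /= wN; apply: zN.
Qed.

(** The power of [T] is cut into boxes indexed by [J], on each of which the integrand is constant;
    the masses enter through the products of box measures. The chosen representative of the class
    agrees with the step function only almost everywhere, hence the first transfer. *)
Lemma Rintegral_lift_step (k : nat) (g : 'M[R]_(k, d) -> R) (y : I -> 'rV[R]_d) :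
  continuous g ->
  \int[mpower mu k]_w g (lift_mx (L2_fun (step y)) w) =
  \sum_(J : {ffun 'I_k -> I}) (\prod_q fine (mu (c @^-1` [set J q]))) *
    g (\matrix_(q, j) y (J q) 0 j).
Proof.
move=> cg.
pose ck (w : k.-tuple T) : {ffun 'I_k -> I} := [ffun q => c (tnth w q)].
have ckE J : ck @^-1` [set J] = box (fun q => c @^-1` [set J q]).
  apply/seteqP; split => w /=; first by move=> <- q; rewrite ffunE.
  by move=> wJ; apply/ffunP => q; rewrite ffunE; exact: wJ.
have mck J : measurable (ck @^-1` [set J]) by rewrite ckE; exact: measurable_box.
transitivity (\int[mpower mu k]_w g (\matrix_(q, j) y (ck w q) 0 j)).
  rewrite /Rintegral; congr fine; apply: ae_eq_integral => //.
  - apply/measurable_EFinP; apply: measurable_lift_mx => //.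
    by have /asboolP[] := L2valP (generic_quotient.repr (step y)).
  - apply/measurable_EFinP.
    exact: (measurable_finite_valued mck (fun J => g (\matrix_(q, j) y (J q) 0 j))).
  - have := ae_mpower_tnth k (repr_L2_class (MkL2fun (step_square_integrable y))).
    apply: filterS => w wE _ /=; congr (g _)%:E; apply/matrixP => q j.
    by rewrite !mxE ffunE /L2_fun wE.
have m1 : (mpower mu k : {measure set _ -> \bar R}) setT = 1%E by exact: mpowerT.
rewrite (Rintegral_finite_valued m1 mck (fun J => g (\matrix_(q, j) y (J q) 0 j))).
apply: eq_bigr => J _; congr (_ * _); rewrite ckE.
by have := mpower_box_fine mu1 (fun q => mc (J q)) => /(congr1 fine).
Qed.

End step_functions.

(** * Level sets of prescribed measure in the cube *)

Section cube_slabs.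
Context {R : realType} {d : nat}.
Local Notation T := (d.-tuple (measurableTypeR R)).

Lemma lebesgue_measure_itv01 : lebesgue_measure (`]0 : R, 1[%classic) = 1%:E.
Proof. by rewrite lebesgue_measure_itv/= lte_fin ltr01 sube0. Qed.

Lemma lebesgue_measure_itv_cap01 (a b : R) : 0 <= a -> a <= b -> b <= 1 ->
  lebesgue_measure (`[a, b[%classic `&` `]0, 1[%classic) = (b - a)%:E.
Proof.
move=> a0 ab b1.
have [a_eq0|a_neq0] := eqVneq a 0.
  rewrite (_ : _ `&` _ = `]a, b[%classic); last first.
    apply/seteqP; split => t /=; rewrite !in_itv/= a_eq0.
      by move=> [/andP[_ ->] /andP[->]].
    by move=> /andP[t0 tb]; rewrite tb t0 (ltW t0) (lt_le_trans tb b1).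
  rewrite lebesgue_measure_itv/= lte_fin; case: ltP => // ba.
  by rewrite (_ : b = a) ?subrr//; apply/eqP; rewrite eq_le ba.
rewrite (_ : _ `&` _ = `[a, b[%classic); last first.
  apply/seteqP; split => t /=; rewrite !in_itv/=; first by case.
  move=> /andP[ta tb]; rewrite tb ta (lt_le_trans tb b1) andbT; split=> //.
  by rewrite (lt_le_trans _ ta)// lt_neqAle eq_sym a_neq0.
rewrite lebesgue_measure_itv/= lte_fin; case: ltP => // ba.
by rewrite (_ : b = a) ?subrr//; apply/eqP; rewrite eq_le ba.
Qed.

Lemma Omega_box : @Omega R d = box (fun=> `]0 : R, 1[%classic).
Proof.
by apply/seteqP; split => w Ow i /=; have := Ow i; rewrite /= in_itv.
Qed.

Lemma muOmega_setT : @muOmega R d setT = 1%E.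
Proof.
rewrite /muOmega /mrestr setTI Omega_box.
rewrite (mpower_box (m := fun=> 1)) ?big1// => _.
exact: lebesgue_measure_itv01.
Qed.

Lemma measurable_slab (i : 'I_d) (a b : R) :
  measurable [set w : T | a <= tnth w i < b].
Proof.
rewrite (_ : [set w | _] = (@tnth _ _ ^~ i) @^-1` `[a, b[%classic).
  by rewrite -[X in measurable X]setTI; exact: measurable_tnth.
by apply/seteqP; split => w /=; rewrite in_itv.
Qed.

Lemma muOmega_slab (i : 'I_d) (a b : R) : 0 <= a -> a <= b -> b <= 1 ->
  muOmega [set w : T | a <= tnth w i < b] = (b - a)%:E.
Proof.
move=> a0 ab b1; rewrite /muOmega /mrestr Omega_box.
rewrite (_ : _ `&` _ = box (fun j : 'I_d =>
    if j == i then `[a, b[%classic `&` `]0, 1[%classic else `]0 : R, 1[%classic)); last first.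
  apply/seteqP; split => [w [/= wab w01] j|w /= wB].
    by case: eqP => [->|_]; [split; [rewrite /= in_itv|exact: w01]|exact: w01].
  split => [|j]; first by have := wB i; rewrite eqxx /= in_itv => -[].
  by have := wB j; case: eqP => // _ [].
rewrite (mpower_box (m := fun j => if j == i then b - a else 1)).
- by rewrite (bigD1 i)//= eqxx big1 ?mulr1// => j /negPf ->.
- by move=> j; case: eqP => // _; exact: measurableI.
move=> j; case: eqP => _; last exact: lebesgue_measure_itv01.
exact: lebesgue_measure_itv_cap01.
Qed.

(** The cube is cut into slabs along its first coordinate, at the partial sums [s] of the masses.
    From slab [i] the initial part of width [e] is split off under the label [None]. The partition
    [c] is chosen before [e], so that one step function serves as base point for all [e]. *)
Lemma exists_slab_partition (n : nat) (m : 'I_n -> R) (i : 'I_n) : (0 < d)%N ->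
  (forall l, 0 <= m l) -> \sum_l m l = 1 ->
  exists2 c : T -> 'I_n, forall l, measurable (c @^-1` [set l]) &
  forall e, 0 <= e <= m i -> exists c' : T -> option 'I_n,
    [/\ forall r, measurable (c' @^-1` [set r]),
        forall r, fine (muOmega (c' @^-1` [set r])) =
          (if r is Some l then m l - (l == i)%:R * e else e) &
        forall w, c w = odflt i (c' w)].
Proof.
move=> d0 m0 m1; pose i0 := Ordinal d0.
pose s (a : nat) : R := \sum_(l < n | (l < a)%N) m l.
have sS (l : 'I_n) : s l.+1 = s l + m l.
  rewrite /s (bigD1 l)//= addrC; congr (_ + _); apply: eq_bigl => l'.
  by rewrite ltnS [RHS]ltn_neqAle andbC.
have s_mono a b : (a <= b)%N -> s a <= s b.
  move=> ab; rewrite /s [leRHS](bigID (fun l : 'I_n => (l < a)%N))/=.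
  rewrite (eq_bigl (fun l : 'I_n => (l < b)%N && (l < a)%N)); last first.
    by move=> l; case: (ltnP l a) => la; rewrite ?andbF// andbT (leq_trans la).
  by rewrite lerDl sumr_ge0.
have s0 : s 0%N = 0 by rewrite /s big_pred0.
have sn : s n = 1 by rewrite -m1; apply: eq_bigl => l; rewrite ltn_ord.
pose slab l := [set w : T | s l <= tnth w i0 < s l.+1].
have slab_inj (l l' : 'I_n) w : slab l w -> slab l' w -> l = l'.
  move=> /andP[h1 h2] /andP[h3 h4]; apply: val_inj; apply/eqP.
  rewrite eqn_leq; apply/andP; split; rewrite leqNgt; apply/negP => /s_mono h.
    by have := le_lt_trans h1 (lt_le_trans h4 h); rewrite ltxx.
  by have := le_lt_trans h3 (lt_le_trans h2 h); rewrite ltxx.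
(* [c] has to be total: a point in no slab gets the label [i]. For this reason the fibre of [i] is
   described below as a complement. *)
pose c (w : T) : 'I_n := odflt i [pick l : 'I_n | s l <= tnth w i0 < s l.+1].
have cslab (l : 'I_n) w : slab l w -> c w = l.
  move=> lw; rewrite /c; case: pickP => [l' l'w|/(_ l)]; last by move: lw => /= ->.
  exact: (slab_inj l' l w).
have cE (l : 'I_n) : l != i -> c @^-1` [set l] = slab l.
  move=> li; apply/seteqP; split => w /=; last exact: cslab.
  rewrite /c; case: pickP => [l' l'w /= <-//|_ /= il]; by rewrite il eqxx in li.
have ci : c @^-1` [set i] = ~` \bigcup_(l in [set l | l != i]) slab l.
  apply/seteqP; split => [w /= cw [l /= li /cslab]|w /= wN].
    by rewrite cw => il; rewrite il eqxx in li.
  rewrite /c; case: pickP => // l lw /=; apply: contra_notP wN => /eqP li.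
  by exists l.
have mslab l : measurable (slab l) by exact: measurable_slab.
have mc l : measurable (c @^-1` [set l]).
  have [->|/cE -> //] := eqVneq l i; rewrite ci; apply: measurableC.
  by apply: fin_bigcup_measurable => //; exact: finite_finset.
have s01 (l : nat) : (l <= n)%N -> 0 <= s l <= 1.
  by move=> ln; rewrite -{1}s0 -sn !s_mono.
have mucE l : muOmega (c @^-1` [set l]) = (m l)%:E.
  transitivity (muOmega (slab l)).
    rewrite /muOmega /mrestr; congr (lebesgueRn _ _ _).
    apply/seteqP; split => w [/= wl Ow]; split => //; last exact: cslab.
    have /andP[w0 w1] := Ow i0.
    (* For [w] in the cube, the least [a] with its coordinate below [s a] is positive, and the
       predecessor of [a] is the slab of [w]. So the default label occurs only on a null set. *)
    have exl : exists a : nat, tnth w i0 < s a by exists n; rewrite sn.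
    case: (ex_minnP exl) => -[|a] wa amin; first by rewrite s0 ltNge (ltW w0) in wa.
    have an : (a < n)%N by apply: amin; rewrite sn.
    have aw : slab (Ordinal an) w.
      apply/andP; split => //=; rewrite leNgt; apply/negP => /amin.
      by rewrite ltnn.
    by rewrite -wl (cslab _ _ aw).
  have [/andP[sl0 _] /andP[_ sl1]] := (s01 l (ltnW (ltn_ord l)), s01 l.+1 (ltn_ord l)).
  by rewrite muOmega_slab ?s_mono// sS addrAC subrr add0r.
exists c => // e /andP[e0 ei].
pose B := [set w : T | s i <= tnth w i0 < s i + e].
have mB : measurable B by exact: measurable_slab.
have muB : muOmega B = e%:E.
  have [/andP[si0 _] /andP[_ si1]] := (s01 i (ltnW (ltn_ord i)), s01 i.+1 (ltn_ord i)).
  rewrite muOmega_slab// ?lerDl// ?[_ + e]addrC ?addrK//.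
  by rewrite addrC (le_trans _ si1)// sS lerD2l.
have Bc w : B w -> c w = i.
  move=> /andP[h1 h2]; apply: cslab; rewrite /slab /= h1 sS (lt_le_trans h2)//.
  by rewrite lerD2l.
pose c' (w : T) := if w \in B then None else Some (c w).
have c'N : c' @^-1` [set None] = B.
  apply/seteqP; split => w; rewrite /c' /=; first by case: ifP => // /set_mem.
  by move=> Bw; rewrite mem_set.
have c'S l : c' @^-1` [set Some l] = c @^-1` [set l] `\` B.
  apply/seteqP; split => w; rewrite /c' /=.
    by case: ifP => // /negbT /negP wB [cw]; split => // Bw; apply: wB; rewrite mem_set.
  by move=> [cw wB]; rewrite memNset// cw.
exists c'; split.
- by case=> [l|]; rewrite ?c'N ?c'S//; exact: measurableD.
- case=> [l|]; last by rewrite c'N muB.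
  rewrite c'S measureD//= ?mucE ?ltry//.
  have [->|li] := eqVneq l i.
    by rewrite (setIidr (_ : B `<=` _)) ?muB ?mul1r//; move=> w /Bc.
  rewrite (_ : _ `&` _ = set0) ?measure0 ?sube0 ?mul0r ?subr0//.
  by apply/seteqP; split => // w [/= cw /Bc]; rewrite cw => il; rewrite il eqxx in li.
- move=> w; rewrite /c'; case: ifP => // /set_mem /Bc //.
Qed.

End cube_slabs.

(** * Polarization *)

Section polarization.
Context {R : comNzRingType} {k : nat}.
Variables (i : 'I_k) (e : R).
Implicit Types (delta : {ffun 'I_k -> bool}) (J : {ffun 'I_k -> option 'I_k}).

(** Up to normalization, the masses of the pieces: 1 or 2 for label [l] according to [delta l], with
    [e] transferred from label [i] to [None]. *)
Definition polar_weight delta (r : option 'I_k) : R :=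
  if r is Some l then (delta l).+1%:R - (l == i)%:R * e else e.

(** For [l != i] the signs form the difference between mass 2 and mass 1; for [l = i] they merely
    select mass 1. *)
Definition polar_sign1 (l : 'I_k) (b : bool) : R :=
  if l == i then (~~ b)%:R else (-1) ^+ (~~ b).

Definition polar_sign delta : R := \prod_l polar_sign1 l (delta l).

Definition polar_coef J : R :=
  \sum_delta polar_sign delta * \prod_q polar_weight delta (J q).

Let N J r : nat := #|[pred q | J q == r]|.

(* The factor of [l != i] vanishes when [J] misses [Some l]; hence, among the [J]
   that take the value [None], only those that take it once, as well as each
   [Some l] with [l != i], have a nonzero coefficient. *)
Lemma polar_coefE J : polar_coef J = e ^+ N J None *
  \prod_l \sum_b polar_sign1 l b * (b.+1%:R - (l == i)%:R * e) ^+ N J (Some l).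
Proof.
rewrite bigA_distr_bigA mulr_sumr; apply: eq_bigr => delta _.
rewrite big_split/= mulrCA; congr (_ * _).
rewrite (partition_big J predT)//=.
rewrite (eq_bigr (fun r => polar_weight delta r ^+ N J r)); last first.
  by move=> r _; rewrite (eq_bigr (fun=> polar_weight delta r)) ?prodr_const// => q /eqP ->.
rewrite (bigD1 None)//=; congr (_ * _).
rewrite (reindex_omap Some id) => [|[]//].
by apply: eq_bigl => l; rewrite /= eqxx.
Qed.

(** The assignments that survive polarization: every row is used exactly once, row [i] in its moved
    version [None]. *)
Definition marked_perm (s : 'S_k) : {ffun 'I_k -> option 'I_k} :=
  [ffun q => if s q == i then None else Some (s q)].

Lemma marked_perm_inj : injective marked_perm.
Proof.
move=> s t st; apply/permP => q; have := congr1 (fun f : {ffun _} => f q) st.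
by rewrite !ffunE; case: eqP => [->|_]; case: eqP => [->|_]// [].
Qed.

(** [None] is taken once and contributes [e]. Each [l != i] is taken once and contributes 2 - 1 = 1.
    [Some i] is never taken, and its factor is the selected term, 1. *)
Lemma polar_coef_marked_perm s : polar_coef (marked_perm s) = e.
Proof.
rewrite polar_coefE.
have NN : N (marked_perm s) None = 1%N.
  rewrite /N (eq_card (B := pred1 (s^-1 i)%g)) ?card1// => q.
  rewrite !inE ffunE (can2_eq (permK s) (permKV s)).
  by case: (q == _).
have NS l : N (marked_perm s) (Some l) = (l != i).
  have [->|li] := eqVneq l i.
    by rewrite /N eq_card0// => q; rewrite !inE ffunE; case: ifP.
  rewrite /N (eq_card (B := pred1 (s^-1 l)%g)) ?card1// => q.
  rewrite !inE ffunE -[RHS](can2_eq (permK s) (permKV s)).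
  by case: ifP => // /eqP ->; apply/esym/negbTE; rewrite eq_sym.
rewrite NN expr1 big1 ?mulr1// => l _; rewrite NS big_bool /polar_sign1.
have [_|_] := eqVneq l i; rewrite /= ?expr0 ?expr1 ?mul0r ?subr0 ?mul1r.
  by rewrite add0r.
by rewrite mulN1r mulrSr addrK.
Qed.

(** [J] takes [None] and, by the nonzero coefficient, each [Some l] with [l != i]. Sending [None] to
    [i] thus gives a surjection of a finite set onto itself, which is a permutation. *)
Lemma polar_coef_neq0 J : None \in codom J -> polar_coef J != 0 ->
  exists s, J = marked_perm s.
Proof.
move=> /codomP[q0 Jq0] J0.
have hit l : l != i -> exists q, J q == Some l.
  move=> li; apply/existsP; apply: contra_neqT J0 => /existsPn Jl.
  rewrite polar_coefE (bigD1 l)//= (_ : N J (Some l) = 0%N); last first.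
    by apply: eq_card0 => q; rewrite !inE; exact/negbTE/Jl.
  rewrite big_bool /polar_sign1 (negPf li) /= expr0 expr1 !mulr1 addrC addNr.
  by rewrite mul0r mulr0.
pose f q := odflt i (J q).
have f_surj l : exists q, f q == l.
  have [->|/hit[q Jq]] := eqVneq l i; first by exists q0; rewrite /f -Jq0.
  by exists q; rewrite /f (eqP Jq).
pose g l := xchoose (f_surj l).
have gK : cancel g f by move=> l; apply/eqP; exact: (xchooseP (f_surj l)).
have fK : cancel f g by apply/(bij_can_sym (injF_bij (can_inj gK))).
have f_inj := can_inj fK.
exists (perm f_inj); apply/ffunP => q; rewrite ffunE permE.
(* The value [Some i] is excluded: by injectivity, an index sent to [i] is [q0], where [J] is
   [None]. *)
case: eqP => [fq|]; last by rewrite /f; case: (J q).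
by rewrite Jq0; congr (J _); apply: f_inj; rewrite fq /f -Jq0.
Qed.

(** After exchange of the sums, [D J] has the coefficient [polar_coef J]. An assignment that misses
    [None] is removed by the assumption on [D]; any other is a marked permutation or has coefficient
    0. *)
Lemma polarization (D : {ffun 'I_k -> option 'I_k} -> R) :
  (forall J, None \notin codom J -> D J = 0) ->
  \sum_delta polar_sign delta *
    (\sum_(J : {ffun 'I_k -> option 'I_k}) (\prod_q polar_weight delta (J q)) * D J) =
  e * \sum_(s : 'S_k) D (marked_perm s).
Proof.
move=> D0; transitivity (\sum_(J : {ffun 'I_k -> option 'I_k}) polar_coef J * D J).
  under eq_bigr do rewrite mulr_sumr; rewrite exchange_big; apply: eq_bigr => J _.
  by rewrite mulr_suml; apply: eq_bigr => delta _; rewrite mulrA.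
rewrite (bigID (mem (imset marked_perm (mem predT))))/= [X in _ + X]big1 ?addr0; last first.
  move=> J JN; have [JNone|/D0 ->] := boolP (None \in codom J); last by rewrite mulr0.
  have [->|/(polar_coef_neq0 JNone)[s Js]] := eqVneq (polar_coef J) 0.
    by rewrite mul0r.
  by rewrite Js imset_f in JN.
rewrite big_imset/=; last by move=> s t _ _; exact: marked_perm_inj.
by rewrite mulr_sumr; apply: eq_bigr => s _; rewrite polar_coef_marked_perm.
Qed.

End polarization.

(** * Vanishing third differences *)

Section vanishing_third_differences.
Context {R : realType} {d k : nat}.
Hypothesis d_gt0 : (0 < d)%N.
Local Notation mu1 := (@muOmega_setT R d).

Variables (g : 'M[R]_(k, d) -> R) (cg : continuous g).
Let F : HH R d -> R := tildePhi g.
Hypothesis dF : forall x, differentiable F x.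
Hypothesis tF : forall x, twice_differentiable F x.

Definition third_difference (f : R -> R) : R := f 3 - 3 * f 2 + 3 * f 1 - f 0.

Lemma third_difference_sum (I : finType) (p : I -> R) (f : I -> R -> R) :
  third_difference (fun a => \sum_r p r * f r a) = \sum_r p r * third_difference (f r).
Proof.
rewrite /third_difference !mulr_sumr -sumrB -big_split -sumrB /=.
by apply: eq_bigr => r _; ring.
Qed.

Section marked_row.
Variables (Y : 'M[R]_(k, d)) (i : 'I_k) (v : 'rV[R]_d).

(** The values on the box of [J] of a step function whose rows are those of [Y], moved by [a *: v]
    on the piece [None]. That piece is cut out of the one of row [i], whence the default [i]. *)
Definition marked_rows (a : R) (J : {ffun 'I_k -> option 'I_k}) : 'M[R]_(k, d) :=
  \matrix_(q, j) (row (odflt i (J q)) Y + a *: (if J q is None then v else 0)) 0 j.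

(* The value [row l Y] is taken on a set of measure proportional to [1 + delta l];
   on a part of the set of row [i], of measure proportional to [e], the function
   is moved to [row i Y + a *: v]. This is a perturbation of squared norm O(e). *)
Lemma polar_third_difference_small (delta : {ffun 'I_k -> bool}) (eta : R) :
  0 < eta -> \forall e \near 0^'+,
  `|\sum_(J : {ffun 'I_k -> option 'I_k}) (\prod_q polar_weight i e delta (J q)) *
     third_difference (fun a => g (marked_rows a J))| <= eta * e.
Proof.
move=> eta0; pose W : R := \sum_l (delta l).+1%:R.
have W1 : 1 <= W.
  by rewrite /W (bigD1 i)//= ler_wpDr ?sumr_ge0// ler1n.
have W0 : 0 < W by rewrite (lt_le_trans _ W1).
have Wn0 : W != 0 by rewrite gt_eqF.
pose m l : R := (delta l).+1%:R / W.
have m0 l : 0 <= m l by rewrite divr_ge0// ltW.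
have m1 : \sum_l m l = 1 by rewrite -mulr_suml divff.
have [c mc cP] := exists_slab_partition i d_gt0 m0 m1.
pose x := step mu1 mc (fun l => row l Y).
pose K := enorm v ^+ 2.
have K0 : 0 <= K by exact: sqr_ge0.
(* [W ^+ k] undoes the division of [k] masses by [W], and [K + 1] absorbs the factor [K] of the
   squared norm of [h] while staying positive when [v] is 0. *)
have eta1 : 0 < eta / (W ^+ k * (K + 1)).
  by rewrite divr_gt0// mulr_gt0 ?exprn_gt0// ltr_wpDl.
have /nbhs_norm0P[r /= r0 rP] := third_difference_small dF (tF x) eta1.
near=> e.
have e0 : 0 < e by near: e; exact: nbhs_right_gt.
have e1 : e <= 1 by near: e; exact: nbhs_right_le.
have er : e < r ^+ 2 / (K + 1).
  by near: e; apply: nbhs_right_lt; rewrite divr_gt0 ?exprn_gt0// ltr_wpDl.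
(* Masses are weights divided by [W], so weight [e] becomes mass [e / W]; with [e <= 1] it fits into
   the piece of row [i], of mass at least [1 / W]. *)
have [|c' [mc' muc' cc']] := cP (e / W).
  rewrite divr_ge0 ?(ltW e0) ?(ltW W0)//= ler_wpM2r ?invr_ge0 ?(ltW W0)//.
  by rewrite (le_trans e1)// ler1n.
pose h := step mu1 mc' (fun o => if o is None then v else 0).
have hE : `|h| ^+ 2 = e / W * K.
  rewrite step_norm_sqr (bigD1 None)//= muc' big1 ?addr0// => -[l|]// _.
  by rewrite enorm0 expr0n mulr0.
have eWe : e / W <= e by rewrite ler_pdivrMr// ler_peMr// ltW.
have heK : `|h| ^+ 2 <= e * K by rewrite hE ler_wpM2r.
have hr : `|h| < r.
  rewrite -(@ltr_pXn2r _ 2)// ?nnegrE ?(ltW r0)//; apply: (le_lt_trans heK).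
  move: er; rewrite ltr_pdivlMr ?ltr_wpDl//; apply: le_lt_trans.
  by rewrite ler_wpM2l ?(ltW e0)// lerDl.
(* The point [x] and the radius [r] were fixed before [e]; [x] is now expressed over the finer
   partition, where [h] can be added to it. *)
have xE : x = step mu1 mc' (fun o => row (odflt i o) Y).
  by apply/L2_classP; apply: nearW => t /=; rewrite cc'.
have FE a : F (x + a *: h) = W ^- k *
    \sum_(J : {ffun 'I_k -> option 'I_k}) (\prod_q polar_weight i e delta (J q)) *
      g (marked_rows a J).
  rewrite xE step_lincomb /F /tildePhi Rintegral_lift_step// mulr_sumr.
  apply: eq_bigr => J _; rewrite mulrA; congr (_ * _).
  have -> : W ^- k = \prod_(q < k) W^-1 by rewrite prodr_const card_ord exprVn.
  rewrite -big_split/=.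
  apply: eq_bigr => q _; rewrite muc' /polar_weight /m; case: (J q) => [l|].
    by rewrite [RHS]mulrC mulrBl mulrA.
  by rewrite mulrC.
rewrite -third_difference_sum.
pose S a := \sum_(J : {ffun 'I_k -> option 'I_k}) (\prod_q polar_weight i e delta (J q)) *
  g (marked_rows a J).
have FS : F (x + 3 *: h) - 3 * F (x + 2 *: h) + 3 * F (x + h) - F x =
    W ^- k * third_difference S.
  have := FE 0; rewrite scale0r addr0 => ->; have := FE 1; rewrite scale1r => ->.
  rewrite !FE -/(S 3) -/(S 2) -/(S 1) -/(S 0) /third_difference.
  by move: (W ^- k) (S 3) (S 2) (S 1) (S 0) => a4 a3 a2 a1 a0; ring.
have := rP h hr; rewrite FS normrM gtr0_norm ?invr_gt0 ?exprn_gt0// => SP.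
have Wk0 : 0 < W ^+ k by rewrite exprn_gt0.
rewrite -ler_pdivlMl// in SP; last by rewrite invr_gt0.
apply: (le_trans SP); rewrite invrK.
have -> : W ^+ k * (eta / (W ^+ k * (K + 1)) * `|h| ^+ 2) = eta * (`|h| ^+ 2 / (K + 1)).
  move: (W ^+ k) Wk0 => w w0.
  by field; rewrite !gt_eqF// ltr_wpDl.
rewrite ler_wpM2l ?(ltW eta0)// ler_pdivrMr ?ltr_wpDl//.
by rewrite (le_trans heK)// ler_wpM2l ?(ltW e0)// lerDl.
Unshelve. all: by end_near. Qed.

End marked_row.

Definition symmetrization (A : 'M[R]_(k, d)) : R := \sum_(s : 'S_k) g (row_perm s A).

(** Polarization writes [e] times this third difference [T] as a signed sum of terms of size at most
    [eta * e]. As [T] is independent of [e], its absolute value is at most [n * eta], which the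
    choice of [eta] makes smaller than [|T|] if [T] is nonzero. *)
Lemma symmetrization_third_difference (Y : 'M[R]_(k, d)) i j (s : R) :
  third_difference (fun a => symmetrization (Y + (a * s) *: delta_mx i j)) = 0.
Proof.
pose v : 'rV[R]_d := s *: delta_mx 0 j.
pose D (J : {ffun 'I_k -> option 'I_k}) := third_difference (fun a => g (marked_rows Y i v a J)).
have D0 (J : {ffun 'I_k -> option 'I_k}) : None \notin codom J -> D J = 0.
  move=> JN; rewrite /D /third_difference.
  (* Without [None] in its image, [J] sees no moved row, and the third difference of a constant is
     0. *)
  have E a : marked_rows Y i v a J = marked_rows Y i v 0 J.
    apply/matrixP => q j'; rewrite !mxE; case Jq: (J q) => [l|].
      by rewrite !mxE !mulr0.
    by rewrite -Jq codom_f in JN.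
  by rewrite !(E 3) !(E 2) !(E 1); ring.
have DE : third_difference (fun a => symmetrization (Y + (a * s) *: delta_mx i j)) =
    \sum_(t : 'S_k) D (marked_perm i t).
  transitivity (\sum_(t : 'S_k) 1 *
      third_difference (fun a => g (row_perm t (Y + (a * s) *: delta_mx i j)))).
    rewrite -third_difference_sum; congr third_difference; apply/funext => a.
    by apply: eq_bigr => t _; rewrite mul1r.
  apply: eq_bigr => t _; rewrite mul1r; congr third_difference; apply/funext => a.
  congr g; apply/matrixP => q j'; rewrite !mxE ffunE; case: eqP => [->|tq] /=.
    by rewrite !mxE eqxx mulrA.
  by rewrite !mxE !mulr0.
rewrite DE; set T := \sum_t _.
apply/eqP; apply/negPn/negP => T0.
pose n : R := \sum_(delta : {ffun 'I_k -> bool}) `|polar_sign i delta| : R.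
have n0 : 0 <= n by apply: sumr_ge0.
have eta0 : 0 < `|T| / (2 * (n + 1)).
  by rewrite divr_gt0 ?normr_gt0// mulr_gt0// ltr_wpDl.
have [e [e0 eP]] : exists e : R, 0 < e /\ forall delta : {ffun 'I_k -> bool},
  `|\sum_(J : {ffun 'I_k -> option 'I_k}) (\prod_q polar_weight i e delta (J q)) * D J| <=
    `|T| / (2 * (n + 1)) * e.
  apply: (@filter_ex _ (0 : R)^'+); near=> e; split; first by near: e; exact: nbhs_right_gt.
  near: e; apply: filter_forall => delta; exact: polar_third_difference_small.
have := polarization i e D0; rewrite -/T => /(congr1 Num.norm).
rewrite normrM (ger0_norm (ltW e0)) => eT.
have : e * `|T| <= n * (`|T| / (2 * (n + 1)) * e).
  rewrite -eT (le_trans (ler_norm_sum _ _ _))// mulr_suml ler_sum// => delta _.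
  by rewrite normrM ler_wpM2l.
have T1 : 0 < `|T| by rewrite normr_gt0.
rewrite [leRHS](_ : _ = e * (n / (2 * (n + 1)) * `|T|)); last first.
  by field; rewrite gt_eqF// ltr_wpDl.
rewrite ler_pM2l// -{1}[`|T|]mul1r ler_pM2r// leNgt => /negP; apply.
by rewrite ltr_pdivrMr ?mulr_gt0 ?ltr_wpDl// mul1r; lra.
Unshelve. all: by end_near. Qed.

Lemma symmetrization_third_difference_free (Y : 'M[R]_(k, d)) i j :
  third_difference_free (fun a => symmetrization (Y + a *: delta_mx i j)).
Proof.
move=> t s; have := symmetrization_third_difference (Y + t *: delta_mx i j) i j s.
by rewrite /third_difference -!addrA -!scalerDl mul0r mul1r addr0.
Qed.

Lemma continuous_symmetrization_line (Y : 'M[R]_(k, d)) i j :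
  continuous (fun a : R => symmetrization (Y + a *: delta_mx i j)).
Proof.
move=> a; rewrite /symmetrization.
apply: cvg_big => [|s _]; first exact: add_continuous.
apply: continuous_cvg; first exact: cg.
have E (b : R) : row_perm s (Y + b *: delta_mx i j) =
    row_perm s Y + b *: row_perm s (delta_mx i j).
  by apply/matrixP => p q; rewrite !mxE.
under eq_cvg do rewrite E; rewrite E.
by apply: cvgD; [exact: cvg_cst|apply: cvgZr_tmp; exact: cvg_id].
Qed.

(** Induction on a list [s] of entries, outside of which all entries are in {0, 1, 2}. For the head
    entry, the values 0, 1 and 2 are covered by the induction hypothesis; the function of this entry
    alone has three zeros and vanishing third differences, so it is 0. *)
Lemma symmetrization_eq0 :
  (forall A : 'M['I_3]_(k, d), symmetrization (map_mx (fun a : 'I_3 => (a : nat)%:R) A) = 0) ->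
  forall Y, symmetrization Y = 0.
Proof.
move=> grid0 Y.
suff P (s : seq ('I_k * 'I_d)) (Z : 'M[R]_(k, d)) :
    (forall p, p \notin s -> exists a : 'I_3, Z p.1 p.2 = (a : nat)%:R) ->
    symmetrization Z = 0.
  by apply: (P (index_enum _)) => p; rewrite mem_index_enum.
elim: s Z => [|[i j] s IHs] Z ZP.
  have ZP' i j : exists a : 'I_3, Z i j == (a : nat)%:R.
    by have [a /eqP] := ZP (i, j) isT; exists a.
  rewrite (_ : Z = map_mx (fun a : 'I_3 => (a : nat)%:R) (\matrix_(i, j) xchoose (ZP' i j))).
    exact: grid0.
  by apply/matrixP => i j; rewrite !mxE; apply/eqP; exact: (xchooseP (ZP' i j)).
pose Z0 := Z - Z i j *: delta_mx i j.
have Z0E (a : 'I_3) : symmetrization (Z0 + (a : nat)%:R *: delta_mx i j) = 0.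
  apply: IHs => -[p q] /= ps; have [[pi qj]|pij] := eqVneq (p, q) (i, j).
    by exists a; rewrite pi qj !mxE !eqxx mulr1 subrr add0r mulr1.
  have [|b ZE] := ZP (p, q); first by rewrite inE negb_or pij.
  exists b; rewrite -ZE !mxE /=.
  rewrite (_ : (p == i) && (q == j) = false) ?mulr0 ?subr0 ?addr0//.
  by apply/negbTE; rewrite -xpair_eqE.
have := third_difference_free_eq0 (@continuous_symmetrization_line Z0 i j)
  (@symmetrization_third_difference_free Z0 i j) (Z0E (Ordinal (isT : (0 < 3)%N)))
  (Z0E (Ordinal (isT : (1 < 3)%N))) (Z0E (Ordinal (isT : (2 < 3)%N))).
by move/(congr1 (fun f => f (Z i j))); rewrite subrK.
Qed.

End vanishing_third_differences.

(** * Conclusion *)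

Section tildePhi_linearity.
Context {R : realType} {d k : nat}.
Implicit Types (g : 'M[R]_(k, d) -> R) (x : HH R d).

Lemma C2_continuous g : C2 g -> continuous g.
Proof. by move=> [dg _ _] x; exact: differentiable_continuous. Qed.

Lemma integrable_tildePhi g x : C2 g -> bounded_hessian g ->
  (mpower (@muOmega R d) k).-integrable setT (EFin \o (g \o lift_mx (L2_fun x))).
Proof.
move=> cg bg; have [C [_ gC]] := bounded_hessian_growth cg bg.
by apply: (integrable_lift_mx muOmega_setT (L2valP _) (C2_continuous cg) gC).
Qed.

Lemma tildePhi_lincomb (a : R) f g : C2 f -> bounded_hessian f ->
  C2 g -> bounded_hessian g ->
  tildePhi (a *: f + g) = a *: tildePhi f + tildePhi g.
Proof.
move=> cf bf cg bg; apply/funext => x.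
have fi := integrable_tildePhi x cf bf; have gi := integrable_tildePhi x cg bg.
rewrite /tildePhi (RintegralD _ _ gi)//; last exact: (integrableZl measurableT a fi).
congr (_ + _); exact: (RintegralZl a measurableT fi).
Qed.

(** By invariance of the product measure, the integral of the symmetrization is the number of
    permutations times [tildePhi g x]. *)
Lemma tildePhi_eq0 g x : C2 g -> bounded_hessian g ->
  (forall A, symmetrization g A = 0) -> tildePhi g x = 0.
Proof.
move=> cg bg sg0; have gi := integrable_tildePhi x cg bg.
pose G (s : 'S_k) w := g (lift_mx (L2_fun x) (tuple_perm s w)).
have : \int[mpower (@muOmega R d) k]_w (\sum_(s : 'S_k) G s w) = 0.
  rewrite /Rintegral integral0_eq// => w _; congr EFin.
  rewrite -[RHS](sg0 (lift_mx (L2_fun x) w)); apply: eq_bigr => s _.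
  by rewrite /G lift_mx_tuple_perm.
rewrite Rintegral_sum => [|s]; last first.
  exact: (integrable_tuple_perm muOmega_setT s gi).
rewrite (eq_bigr (fun=> tildePhi g x)) => [|s _]; last first.
  exact: (Rintegral_tuple_perm muOmega_setT s gi).
(* The number of permutations is nonzero since the identity is one. *)
rewrite sumr_const => /eqP; rewrite mulrn_eq0 => /orP[/eqP/card0_eq/(_ 1%g)//|/eqP//].
Qed.

Definition grid_values g : 'rV[R]_#|{: 'M['I_3]_(k, d)}| :=
  \row_n symmetrization g (map_mx (fun a : 'I_3 => (a : nat)%:R) (enum_val n)).

Lemma grid_values_linear : linear grid_values.
Proof.
move=> a f g; apply/rowP => n; rewrite !mxE /symmetrization mulr_sumr -big_split.
by apply: eq_bigr.
Qed.

HB.instance Definition _ := GRing.isLinear.Build R ('M[R]_(k, d) -> R) _ _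
  grid_values grid_values_linear.

Lemma grid_values_eq0 g : grid_values g = 0 ->
  forall A : 'M['I_3]_(k, d),
    symmetrization g (map_mx (fun a : 'I_3 => (a : nat)%:R) A) = 0.
Proof.
by move=> /rowP g0 A; have := g0 (enum_rank A); rewrite !mxE enum_rankK.
Qed.

End tildePhi_linearity.

Theorem propositionA2 (R : realType) (d : nat) (d_gt0 : (0 < d)%N)
    (alpha : R) (alpha01 : 0 < alpha <= 1) (k : nat) :
  finite_dimensional
    ([set F : HH R d -> R | C2alpha_loc alpha F] `&`
     [set tildePhi g | g in [set g : 'M[R]_(k, d) -> R |
                              C2alpha_loc alpha g /\ bounded_hessian g]]).
Proof.
(* The regularity of [tildePhi g] is made a condition on [g], so that the intersection becomes the
   image under [tildePhi] of a set stable under linear combinations. *)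
pose A := [set g : 'M[R]_(k, d) -> R | [/\ C2alpha_loc alpha g, bounded_hessian g
  & C2alpha_loc alpha (tildePhi g : HH R d -> R)]].
have tildePhi0 : tildePhi (0 : 'M[R]_(k, d) -> R) = 0 :> (HH R d -> R).
  by apply/funext => x; rewrite /tildePhi /Rintegral integral0_eq.
rewrite (_ : _ `&` _ = (@tildePhi R d k) @` A); last first.
  apply/seteqP; split => [F [hF [g [hg bg] gF]]|_ [g [hg bg hF] <-]].
    exists g; last exact: gF.
    by split; [exact: hg|exact: bg|rewrite gF; exact: hF].
  by split; [exact: hF|exists g; [split; [exact: hg|exact: bg]|reflexivity]].
apply: (finite_dimensional_image (c := @grid_values R d k)).
- split; [exact: C2alpha_loc0|exact: bounded_hessian0|].
  by rewrite tildePhi0; exact: C2alpha_loc0.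
- move=> a f g [hf bf hPf] [hg bg hPg]; have [cf _] := hf; have [cg _] := hg.
  split; [exact: C2alpha_loc_lincomb|exact: bounded_hessian_lincomb|].
  by rewrite (tildePhi_lincomb a cf bf cg bg); exact: C2alpha_loc_lincomb.
- by move=> a f g [[cf _] bf _] [[cg _] bg _]; exact: tildePhi_lincomb.
move=> g [[cg _] bg [[dF tF _] _]] /grid_values_eq0 g0; apply/funext => x.
exact: (tildePhi_eq0 x cg bg (symmetrization_eq0 d_gt0 (C2_continuous cg) dF tF g0)).
Qed.
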